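(* Let $H$ be a 2-connected graph other than $K_3$ or $K_4$. Then, as $n\to\infty$, $$\frac{\operatorname{gap}_H(n)}{n}\;\to\;\operatorname{limp}(H),\qquad\text{and}\qquad \operatorname{limp}(H)>0.$$
   Context: Graphs are finite and simple. A graph $G$ contains $H$ as a minor if a graph isomorphic to $H$ can be obtained from a subgraph of $G$ by edge contractions (discarding loops and multiple edges). $G$ is $H$-free if it has no minor $H$. An $H$-free graph is edge-maximal $H$-free if adding any edge between two non-adjacent vertices creates a graph with a minor $H$. For $H$ with at least one edge and $n\ge 1$, let $E_H(n)=\{e(G): G \text{ is an edge-maximal } H\text{-free graph on } n \text{ vertices}\}$, where $e(G)$ is the number of edges, let $\operatorname{gap}_H(n)=\max E_H(n)-\min E_H(n)$, and let $\operatorname{limp}(H)=\liminf_{n\to\infty}\operatorname{gap}_H(n)/n$. The connectivity of a graph is the minimum size of a vertex cut, except that $K_n$ ($n\ge2$) has connectivity $n-1$; a graph is 2-connected if its connectivity is at least 2 (so $K_2$ is not 2-connected). *)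

(* Defs.v *)
From HB Require Import structures.
From mathcomp Require Import all_boot all_order all_algebra.
From mathcomp Require Import all_classical all_reals all_analysis.
Set Implicit Arguments.
Unset Strict Implicit.
Unset Printing Implicit Defensive.

Import Order.TTheory GRing.Theory Num.Theory.
Import numFieldNormedType.Exports.

Local Open Scope ring_scope.

Record sgraph := SGraph {
  vertex :> finType;
  adj : rel vertex;
  adj_sym : symmetric adj;
  adj_irrefl : irreflexive adj }.

Arguments adj {s} x y.

Definition edges (G : sgraph) : {set {set G}} :=
  [set E | [exists x : G, exists y : G, adj x y && (E == [set x; y])]].

Definition num_edges (G : sgraph) : nat := #|edges G|.

Definition isomorphic (G K : sgraph) : Prop :=
  exists2 f : G -> K, bijective f & forall x y, adj (f x) (f y) = adj x y.

Lemma complete_sym n : symmetric (fun x y : 'I_n => x != y).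
Proof. by move=> x y; rewrite eq_sym. Qed.

Lemma complete_irrefl n : irreflexive (fun x y : 'I_n => x != y).
Proof. by move=> x; rewrite eqxx. Qed.

Definition complete_graph (n : nat) : sgraph :=
  SGraph (@complete_sym n) (@complete_irrefl n).

(* Up to isomorphism: [K] is a copy of a (not necessarily induced) subgraph
   of [G]. *)
Definition subgraph (K G : sgraph) : Prop :=
  exists2 f : K -> G, injective f & forall x y, adj x y -> adj (f x) (f y).

(* Contraction of the edge xy: [y] is deleted and [x] plays the role of the
   merged vertex. *)
Section Contract.
Variables (G : sgraph) (x y : G).

Definition contract_rel : rel {v : G | v != y} := fun u v =>
  (u != v) && [|| adj (val u) (val v),
                  (val u == x) && adj y (val v)
                | (val v == x) && adj (val u) y].

Lemma contract_sym : symmetric contract_rel.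
Proof.
move=> u v; rewrite /contract_rel eq_sym (adj_sym (val u)) (adj_sym y).
by rewrite (adj_sym (val u) y); congr (_ && (_ || _)); exact: orbC.
Qed.

Lemma contract_irrefl : irreflexive contract_rel.
Proof. by move=> u; rewrite /contract_rel eqxx. Qed.

Definition contract : sgraph := SGraph contract_sym contract_irrefl.

End Contract.

Inductive contracts_to : sgraph -> sgraph -> Prop :=
| contracts_refl (G : sgraph) : contracts_to G G
| contracts_step (G K : sgraph) (x y : G) :
    adj x y -> contracts_to (contract x y) K -> contracts_to G K.

Definition has_minor (G H : sgraph) : Prop :=
  exists K L : sgraph, [/\ subgraph K G, contracts_to K L & isomorphic L H].

Definition minor_free (H G : sgraph) : Prop := ~ has_minor G H.

Section AddEdge.
Variables (G : sgraph) (x y : G).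

(* The guard [x != y] only serves to keep the graph loopless. *)
Definition add_edge_rel : rel G := fun u v =>
  adj u v ||
  (x != y) && ((u == x) && (v == y) || (u == y) && (v == x)).

Lemma add_edge_sym : symmetric add_edge_rel.
Proof.
move=> u v; rewrite /add_edge_rel adj_sym; congr (_ || (_ && _)).
by rewrite orbC (andbC (u == y)) (andbC (u == x)).
Qed.

Lemma add_edge_irrefl : irreflexive add_edge_rel.
Proof.
move=> u; rewrite /add_edge_rel adj_irrefl /= (andbC (u == y)) orbb.
by case: eqP => //= xy; case: eqP => //= ->; apply/eqP.
Qed.

Definition add_edge : sgraph := SGraph add_edge_sym add_edge_irrefl.

End AddEdge.

Definition edge_maximal_free (H G : sgraph) : Prop :=
  minor_free H G /\
  forall x y : G, x != y -> ~~ adj x y -> has_minor (add_edge x y) H.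

Definition edge_counts (H : sgraph) (n : nat) : set nat :=
  [set m | exists G : sgraph,
     [/\ #|G| = n, edge_maximal_free H G & num_edges G = m]].

(* A graph on [n] vertices has at most ['C(n, 2)] edges, so the extrema below
   range over all of [edge_counts H n]. *)
Definition max_edges (H : sgraph) (n : nat) : nat :=
  (\max_(m < 'C(n, 2).+1 | `[< edge_counts H n m >]) m)%N.

Definition min_edges (H : sgraph) (n : nat) : nat :=
  \big[minn/'C(n, 2)]_(m < 'C(n, 2).+1 | `[< edge_counts H n m >]) m.

Definition gap (H : sgraph) (n : nat) : nat :=
  (max_edges H n - min_edges H n)%N.

Definition gap_ratio (R : realType) (H : sgraph) : R^nat :=
  fun n => (gap H n)%:R / n%:R.

Definition limp (R : realType) (H : sgraph) : R := limn_inf (gap_ratio R H).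

Definition vertex_cut (G : sgraph) (S : {set G}) : bool :=
  [exists x : G, exists y : G,
     [&& x \notin S, y \notin S
       & ~~ connect [rel u v | [&& u \notin S, v \notin S & adj u v]] x y]].

Definition is_complete (G : sgraph) : bool :=
  [forall x : G, forall y : G, (x != y) ==> adj x y].

(* A noncomplete graph always has a vertex cut.  The one-vertex graph gets
   connectivity 0. *)
Definition connectivity (G : sgraph) : nat :=
  if is_complete G then #|G|.-1
  else \big[minn/#|G|]_(S : {set G} | vertex_cut S) #|S|.

Definition two_connected (G : sgraph) : bool := (2 <= connectivity G)%N.

(* Main.v *)
Require Import Defs.
From HB Require Import structures.
From mathcomp Require Import all_boot boolp zify.
Set Implicit Arguments.
Unset Strict Implicit.
Unset Printing Implicit Defensive.

(** Write h for the number of vertices of H, and M(n), m(n) for the largest and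
    least number of edges of an edge-maximal H-free graph on n vertices, so
    that gap(n) = M(n) - m(n).

    Convergence.  An edge-maximal H-free graph is connected
    ([edge_maximal_connected]), because H, being 2-connected, cannot use a
    bridge.  Take a disjoint union of two edge-maximal graphs and extend it to
    an edge-maximal graph.  No edge appears inside a part; if a connected set
    outside a part sends edges to two vertices a, b of that part, contracting
    it onto a produces the edge ab, so ab was already there.  Hence the new
    edges join a clique to a clique ([edge_maximal_union]), and cliques have
    fewer than h vertices: at most h^2 edges are created.  Doing this with
    densest and with sparsest graphs gives
    gap(a) + gap(b) <= gap(a + b) + h^2 ([gap_add]).  Mader's argument bounds
    gap(n)/n ([gap_linear]), so gap(n)/n converges to the supremum of
    (gap(n) - h^2)/n by Fekete's lemma ([superadditive_ratio]).  That supremum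
    is positive as soon as gap(n) > h^2 for a single n, and it remains to show
    that the gap is unbounded.

    H not complete ([gap_unbounded_noncomplete]).  Let d be the minimum degree
    of H.  To K_(h-1) attach, for each set S of d-1 of its vertices, a new
    vertex with neighbourhood S.  The result is edge-maximal H-free, and the
    new vertices form an independent set W of vertices of degree d-1.  When
    copies are united one by one as above, each step spoils at most one
    such vertex on either side, because a clique meets an independent set at
    most once.  So there are edge-maximal graphs G with arbitrarily large
    independent sets W of vertices of degree at most d-1.  Removing W shows
    e(G) <= M(n - |W|) + (d-1)|W|, while M(n) >= M(n - |W|) + M(|W|).  Thus
    gap(n) >= M(|W|) - (d-1)|W|, and M(g) grows at least like (d - 1/2)g: join
    a clique K_s, where s = max(1, 2d+1-h), to many disjoint copies of
    K_(h-1-s).  This graph is H-free because deleting at most s vertices does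
    not disconnect H.

    H complete.  Adding a universal vertex to all graphs shows
    gap_(K_(r+1))(n+1) >= gap_(K_r)(n) ([gap_cone]), which reduces the case to
    K_5.  There, uniting copies of the Wagner graph gives edge-maximal graphs
    with at most 20 edges per 8 vertices, whereas K_3 joined to an independent
    set has about 24 edges per 8 vertices. *)

(** * Minors and branch sets *)

Lemma connect_invariant (T : finType) (e : rel T) (P : T -> Prop) x y :
  (forall u v, P u -> e u v -> P v) -> connect e x y -> P x -> P y.
Proof.
move=> step /connectP[p + ->] {y}.
elim: p x => [|z p IHp] x //= /andP[xz zp] Px.
by apply: IHp zp _; apply: step xz.
Qed.

Lemma connect_image (T T' : finType) (e : rel T) (e' : rel T') (f : T -> T')
    x y :
  (forall u v, e u v -> connect e' (f u) (f v)) ->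
  connect e x y -> connect e' (f x) (f y).
Proof.
move=> fP xy.
apply: (connect_invariant (P := fun z => connect e' (f x) (f z))) xy _ => //.
by move=> u v xu /fP; apply: connect_trans.
Qed.

Section ConnectedSets.
Variable G : sgraph.
Implicit Types S : {set G}.

Definition set_adj S : rel G := [rel u v | [&& u \in S, v \in S & adj u v]].

Definition connected_in S : Prop :=
  forall x y, x \in S -> y \in S -> connect (set_adj S) x y.

Lemma set_adj_sym S : symmetric (set_adj S).
Proof. by move=> x y; rewrite /set_adj /= adj_sym andbCA. Qed.

Lemma connected_in1 x : connected_in [set x].
Proof. by move=> y z /set1P-> /set1P->. Qed.

Lemma set_adj_sub S S' : S \subset S' -> subrel (set_adj S) (set_adj S').
Proof.
by move=> /subsetP sSS' x y /and3P[/sSS' Sx /sSS' Sy xy]; rewrite /set_adj /= Sx Sy.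
Qed.

Lemma connect_sub_set S S' x y :
  S \subset S' -> connect (set_adj S) x y -> connect (set_adj S') x y.
Proof.
move=> sSS'; apply: connect_sub => u v uv.
by apply: connect1; apply: set_adj_sub uv.
Qed.

End ConnectedSets.

(** The sets B u are the branch sets of a minor H. This form of the minor
    relation is easier to build and to refute than sequences of contractions;
    [has_minorP] shows that the two agree. *)
Record minor_model (G H : sgraph) (B : H -> {set G}) : Prop := MinorModel {
  model_neq0 : forall u, B u != set0;
  model_connected : forall u, connected_in (B u);
  model_disjoint : forall u v x, x \in B u -> x \in B v -> u = v;
  model_adj : forall u v, adj u v ->
    exists x y, [/\ x \in B u, y \in B v & adj x y] }.

Arguments model_neq0 {G H B} _ u.
Arguments model_connected {G H B} _ u.
Arguments model_disjoint {G H B} _ {u v x} _ _.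
Arguments model_adj {G H B} _ {u v} _.

Definition has_model (G H : sgraph) : Prop :=
  exists B : H -> {set G}, minor_model B.

Lemma connected_bigcup (G K : sgraph) (D : K -> {set G}) (S : {set K}) :
  minor_model D -> connected_in S -> connected_in (\bigcup_(k in S) D k).
Proof.
move=> mD cS p q /bigcupP[k Sk pk] /bigcupP[l Sl ql].
have kl := cS _ _ Sk Sl.
have sD j : j \in S -> D j \subset \bigcup_(k in S) D k by move=> Sj; apply: bigcup_sup.
suff: l \in S /\ forall q, q \in D l -> connect (set_adj (\bigcup_(k in S) D k)) p q.
  by case=> _; apply.
apply: (connect_invariant (P := fun l => l \in S /\ forall q, q \in D l ->
   connect (set_adj (\bigcup_(k in S) D k)) p q)) kl _.
- move=> u v [Su IHu] /and3P[_ Sv /(model_adj mD)[a [b [au bv ab]]]].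
  split=> // r rv; apply: (connect_trans (IHu _ au)).
  apply: (@connect_trans _ _ b).
    apply: connect1; rewrite /set_adj /= ab (subsetP (sD _ Su) _ au).
    by rewrite (subsetP (sD _ Sv) _ bv).
  by apply: connect_sub_set (sD _ Sv) _; apply: (model_connected mD).
- split=> // r rk; apply: connect_sub_set (sD _ Sk) _.
  exact: (model_connected mD).
Qed.

(** The branch set of v is the union of the branch sets of the vertices in the
    branch set of v in K; it is connected because adjacent vertices of K have
    branch sets joined by an edge. *)
Lemma has_model_trans (G K H : sgraph) :
  has_model G K -> has_model K H -> has_model G H.
Proof.
move=> [D mD] [B mB]; exists (fun v => \bigcup_(k in B v) D k); split.
- move=> u; have /set0Pn[k ku] := model_neq0 mB u.
  have /set0Pn[x xk] := model_neq0 mD k.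
  by apply/set0Pn; exists x; apply/bigcupP; exists k.
- by move=> u; apply: (connected_bigcup mD (model_connected mB u)).
- move=> u v x /bigcupP[k ku xk] /bigcupP[l lv xl].
  by have kl := model_disjoint mD xk xl; subst l; apply: (model_disjoint mB ku lv).
- move=> u v /(model_adj mB)[k [l [ku lv /(model_adj mD)[x [y [xk yl xy]]]]]].
  by exists x, y; split=> //; apply/bigcupP; [exists k | exists l].
Qed.

Lemma subgraph_model (K G : sgraph) : subgraph K G -> has_model G K.
Proof.
case=> f injf fP; exists (fun u => [set f u]); split.
- by move=> u; apply/set0Pn; exists (f u); rewrite set11.
- by move=> u; apply: connected_in1.
- by move=> u v x /set1P-> /set1P/injf.
- by move=> u v uv; exists (f u), (f v); rewrite !set11; split=> //; apply: fP.
Qed.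

Lemma isomorphic_subgraph (G H : sgraph) : isomorphic G H -> subgraph G H.
Proof.
by case=> f /bij_inj injf fP; exists f => // x y; rewrite fP.
Qed.

Lemma isomorphic_sym (G H : sgraph) : isomorphic G H -> isomorphic H G.
Proof.
case=> f [g fK gK] fP; exists g; first by exists f.
by move=> x y; rewrite -fP !gK.
Qed.

Lemma contract_model (G : sgraph) (x y : G) :
  adj x y -> has_model G (contract x y).
Proof.
move=> xy.
have memB (u : contract x y) z :
    z \in (if val u == x then [set x; y] else [set val u]) =
    (z == val u) || (val u == x) && (z == y).
  by case: eqP => [->|_]; rewrite !inE ?orbF.
exists (fun u : contract x y => if val u == x then [set x; y] else [set val u]).
split.
- move=> u; apply/set0Pn; exists (val u); rewrite memB eqxx //.
- move=> u; case: eqP => _; last exact: connected_in1.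
  move=> a b /set2P[]-> /set2P[]-> //; apply: connect1.
    by rewrite /set_adj /= !inE !eqxx orbT.
  by rewrite /set_adj /= !inE !eqxx orbT adj_sym.
- move=> u v z; rewrite !memB.
  case: (eqVneq z y) => [->|zy].
    have ny (w : contract x y) : (y == val w) = false.
      by rewrite eq_sym; apply/negbTE; apply: (valP w).
    rewrite !ny !andbT /= => /eqP ux /eqP vx.
    by apply: val_inj; rewrite /= ux vx.
  by rewrite !andbF !orbF => /eqP-> /eqP; apply: val_inj.
- move=> u v /andP[_ /or3P[uv|/andP[/eqP ux yv]|/andP[/eqP vx uy]]].
  + by exists (val u), (val v); rewrite !memB !eqxx.
  + by exists y, (val v); rewrite !memB ux !eqxx orbT.
  + by exists (val u), y; rewrite !memB vx !eqxx orbT.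
Qed.

Lemma has_minor_model (G H : sgraph) : has_minor G H -> has_model G H.
Proof.
case=> K [L [/subgraph_model GK KL /isomorphic_sym/isomorphic_subgraph]].
move/subgraph_model=> LH; apply: has_model_trans GK _.
elim: KL LH => {G K L}// G K' x y xy _ IH LH.
by apply: has_model_trans (contract_model xy) (IH LH).
Qed.

Section ContractFibers.
Variables (K H : sgraph).

(** A minor model that covers K and whose branch sets are the fibres of f.
    Because of [fiber_hom], contracting all the fibres yields exactly H, with
    no superfluous edge. *)
Record fiber_map (f : K -> H) : Prop := FiberMap {
  fiber_surj : forall v, exists x, f x = v;
  fiber_connected : forall v, connected_in [set x | f x == v];
  fiber_hom : forall x y, adj x y -> f x != f y -> adj (f x) (f y);
  fiber_adj : forall u v, adj u v ->
    exists x y, [/\ f x = u, f y = v & adj x y] }.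

End ContractFibers.
Arguments fiber_surj {K H f} _ v.
Arguments fiber_connected {K H f} _ v.
Arguments fiber_hom {K H f} _ {x y} _ _.
Arguments fiber_adj {K H f} _ {u v} _.

Lemma fiber_map_inj_iso (K H : sgraph) (f : K -> H) :
  fiber_map f -> injective f -> isomorphic K H.
Proof.
move=> fm injf; exists f.
  have card_KH : #|H| <= #|K|.
    rewrite -(card_codom injf); apply: subset_leq_card; apply/subsetP=> v _.
    by have [x <-] := fiber_surj fm v; apply: codom_f.
  exact: inj_card_bij injf card_KH.
move=> x y; apply/idP/idP => [|xy].
  by case/(fiber_adj fm)=> x' [y' [/injf-> /injf->]].
apply: (fiber_hom fm) => //; apply: contraTneq xy => /injf->.
by rewrite adj_irrefl.
Qed.

(** The map that sends z to x and fixes the other vertices sends each edge to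
    an edge or a point, so it carries the connectivity and the edges between
    fibres over to the contracted graph. *)
Lemma fiber_map_contract (K H : sgraph) (f : K -> H) (x z : K) :
  fiber_map f -> adj x z -> f x = f z ->
  fiber_map (fun u : contract x z => f (val u)).
Proof.
move=> fm xz fxz.
have nxz : x != z by apply: contraTneq xz => ->; rewrite adj_irrefl.
pose x' : contract x z := Sub x nxz.
pose pr p : contract x z := insubd x' p.
have val_pr p : val (pr p) = if p == z then x else p.
  by rewrite /pr val_insubd; case: eqP.
have fpr p : f (val (pr p)) = f p by rewrite val_pr; case: eqP => // ->.
have prK u : pr (val u) = u by apply: valKd.
have pr_adj p q : adj p q -> pr p != pr q -> adj (pr p) (pr q).
  move=> pq npq; rewrite /= /contract_rel npq /= !val_pr.
  case: (eqVneq p z) (eqVneq q z) => [pz|pz] [qz|qz].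
  - by rewrite pz qz eqxx in npq.
  - by rewrite -pz pq eqxx !orbT.
  - by rewrite eqxx /= -qz pq !orbT.
  - by rewrite pq.
split.
- by move=> v; have [p <-] := fiber_surj fm v; exists (pr p).
- move=> v p q; rewrite !inE => pv qv; rewrite -(prK p) -(prK q).
  have := fiber_connected fm v (val p) (val q).
  rewrite !inE => /(_ pv qv); apply: connect_image => a b /and3P[].
  rewrite !inE => av bv ab; case: (eqVneq (pr a) (pr b)) => [->//|nab].
  by apply: connect1; rewrite /set_adj /= !inE !fpr av bv; apply: pr_adj.
- move=> p q /andP[_ /or3P[pq|/andP[/eqP px zq]|/andP[/eqP qx zp]]] nf.
  + exact: fiber_hom.
  + by move: nf; rewrite px fxz; apply: fiber_hom.
  + by move: nf; rewrite qx fxz; apply: fiber_hom.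
- move=> u v uv; have [p [q [pu qv pq]]] := fiber_adj fm uv.
  exists (pr p), (pr q); rewrite !fpr; split=> //; apply: pr_adj => //.
  apply: contraTneq uv => /(congr1 (fun w => f (val w))).
  by rewrite !fpr pu qv => ->; rewrite adj_irrefl.
Qed.

(** A fibre with two vertices is connected, so it contains an edge, and
    contracting it preserves the hypotheses; once f is injective it is an
    isomorphism. *)
Lemma fiber_map_contracts (K H : sgraph) (f : K -> H) :
  fiber_map f -> exists2 L, contracts_to K L & isomorphic L H.
Proof.
move: {2}(#|K|) (leqnn #|K|) => n; elim: n => [|n IHn] in K f *.
  rewrite leqn0 => /eqP K0 fm; exists K; first exact: contracts_refl.
  apply: (fiber_map_inj_iso fm) => x.
  by have := fintype0 x K0.
move=> leK fm.
have [injf|] := boolP (injectiveb f).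
  exists K; first exact: contracts_refl.
  by apply: (fiber_map_inj_iso fm); apply/injectiveP.
case/injectivePn=> x [y nxy fxy].
have := fiber_connected fm (f x) x y.
rewrite !inE fxy eqxx => /(_ isT isT) /connectP[[|z p] /=].
  by move=> _ exy; rewrite exy eqxx in nxy.
case/andP=> /and3P[_ + xz] _ _; rewrite inE -fxy => /eqP fzx.
have fm' := fiber_map_contract fm xz (esym fzx).
have [|L KL LH] := IHn _ _ _ fm'; last first.
  by exists L => //; apply: contracts_step xz KL.
have -> : #|contract x z| = #|K|.-1.
  by rewrite card_sig (cardC1 z).
by move: leK; case: #|K|.
Qed.

(** Delete the vertices outside all branch sets, and the edges between branch
    sets of vertices that are not adjacent in H; what remains has H as a total
    quotient with connected fibres. *)
Lemma model_has_minor (G H : sgraph) : has_model G H -> has_minor G H.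
Proof.
case=> B mB.
pose V := {z : G | [exists v, z \in B v]}.
pose f (z : V) : H := xchoose (existsP (valP z)).
have fB z : val z \in B (f z) := xchooseP (existsP (valP z)).
have fE z v : val z \in B v -> f z = v by apply: (model_disjoint mB (fB z)).
pose r : rel V := fun x y =>
  adj (val x) (val y) && ((f x == f y) || adj (f x) (f y)).
have rs : symmetric r by move=> x y; rewrite /r adj_sym eq_sym (adj_sym (f x)).
have ri : irreflexive r by move=> x; rewrite /r adj_irrefl.
pose K := SGraph rs ri.
have inV v z : z \in B v -> {z' : V | val z' = z}.
  move=> zv; suff zP : [exists v, z \in B v] by exists (Sub z zP).
  by apply/existsP; exists v.
have fm : @fiber_map K H f.
  split.
  - move=> v; have /set0Pn[z zv] := model_neq0 mB v.
    by have [z' z'E] := inV _ _ zv; exists z'; apply: fE; rewrite z'E.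
  - move=> v x y; rewrite !inE => /eqP fx /eqP fy.
    have xv := fB x; have yv := fB y; rewrite fx fy in xv yv.
    suff: connect (@set_adj K [set z | f z == v])
        (insubd x (val x)) (insubd x (val y)) by rewrite !valKd.
    apply: connect_image (model_connected mB v _ _ xv yv) => a b.
    case/and3P=> av bv ab; have [a' a'E] := inV _ _ av.
    have [b' b'E] := inV _ _ bv; rewrite -a'E -b'E !valKd.
    have fa : f a' = v by apply: fE; rewrite a'E.
    have fb : f b' = v by apply: fE; rewrite b'E.
    by apply: connect1; rewrite /set_adj /= !inE fa fb eqxx /r a'E b'E ab fa fb eqxx.
  - by move=> x y /andP[_ /orP[->|//]].
  - move=> u v uv; have [x [y [xu yv xy]]] := model_adj mB uv.
    have [x' x'E] := inV _ _ xu; have [y' y'E] := inV _ _ yv.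
    have fx : f x' = u by apply: fE; rewrite x'E.
    have fy : f y' = v by apply: fE; rewrite y'E.
    by exists x', y'; split=> //; rewrite /= /r x'E y'E xy fx fy uv orbT.
have [L KL LH] := fiber_map_contracts fm.
exists K, L; split=> //; exists val; first exact: val_inj.
by move=> x y /andP[].
Qed.

Lemma has_minorP (G H : sgraph) : has_minor G H <-> has_model G H.
Proof. by split; [apply: has_minor_model | apply: model_has_minor]. Qed.

Lemma has_minor_trans (G K H : sgraph) :
  has_minor G K -> has_minor K H -> has_minor G H.
Proof. by rewrite !has_minorP; apply: has_model_trans. Qed.

Lemma subgraph_minor (K G : sgraph) : subgraph K G -> has_minor G K.
Proof. by rewrite has_minorP; apply: subgraph_model. Qed.

(** * Counting edges, and edge-maximal extensions *)

(** Ordered pairs of related vertices: for a graph, twice the number of edges,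
    but expressed by sums over vertices. *)
Definition darts (T : finType) (r : rel T) : nat := \sum_x \sum_y r x y.

Lemma dartsE (T : finType) (r : rel T) :
  darts r = #|[set p : T * T | r p.1 p.2]|.
Proof.
rewrite /darts pair_bigA /= -sum1dep_card [RHS]big_mkcond.
by apply: eq_bigr => p _; case: (r _ _).
Qed.

Lemma adj_neq (G : sgraph) (x y : G) : adj x y -> x != y.
Proof. by apply: contraTneq => ->; rewrite adj_irrefl. Qed.

Lemma darts_double (G : sgraph) : darts (@adj G) = (num_edges G).*2.
Proof.
rewrite dartsE -sum1dep_card.
rewrite (partition_big (fun p : G * G => [set p.1; p.2]) (mem (edges G))) /=.
  rewrite (eq_bigr (fun=> 2)) ?sum_nat_const ?muln2 // => E.
  rewrite inE => /existsP[x /existsP[y /andP[xy /eqP->]]].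
  have nxy := adj_neq xy.
  rewrite sum1_card -[RHS](_ : #|[set (x, y); (y, x)]| = 2); last first.
    by rewrite cards2 xpair_eqE negb_and nxy.
  apply: eq_card => -[a b]; rewrite !inE /= unfold_in /= !xpair_eqE.
  apply/andP/idP => [[ab /eqP E2]|].
    have : a \in [set x; y] by rewrite -E2 set21.
    have : b \in [set x; y] by rewrite -E2 set22.
    have nab := adj_neq ab.
    case/set2P=> eb /set2P[] ea; subst a b; rewrite ?eqxx ?orbT //;
      by rewrite eqxx in nab.
  by case/orP=> /andP[/eqP-> /eqP->]; rewrite ?xy ?(adj_sym y) ?xy ?eqxx // setUC.
move=> [x y] /= xy; rewrite inE; apply/existsP; exists x; apply/existsP.
by exists y; rewrite xy eqxx.
Qed.

Lemma num_edges_le_bin (G : sgraph) : num_edges G <= 'C(#|G|, 2).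
Proof.
rewrite -cardsT -cards_draws; apply: subset_leq_card; apply/subsetP=> E.
rewrite !inE => /existsP[x /existsP[y /andP[xy /eqP->]]].
by rewrite subsetT cards2 (adj_neq xy).
Qed.

Lemma leq_darts (T : finType) (r r' : rel T) :
  subrel r r' -> darts r <= darts r'.
Proof.
move=> sr; apply: leq_sum => x _; apply: leq_sum => y _.
by case: (boolP (r x y)) => // /sr->.
Qed.

Definition nbrs (G : sgraph) (x : G) : {set G} := [set y | adj x y].

Definition clique (G : sgraph) (Q : {set G}) : Prop :=
  forall x y, x \in Q -> y \in Q -> x != y -> adj x y.

Definition graph_connected (G : sgraph) : Prop :=
  forall x y : G, connect adj x y.

Lemma clique_subgraph (G H : sgraph) (Q : {set G}) :
  clique Q -> #|H| <= #|Q| -> subgraph H G.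
Proof.
move=> cQ leHQ; pose f (v : H) : G := enum_val (widen_ord leHQ (enum_rank v)).
have injf : injective f.
  by move=> u v /enum_val_inj/(congr1 val)/= /val_inj/enum_rank_inj.
exists f => // x y xy; apply: cQ; try exact: enum_valP.
by rewrite (inj_eq injf); apply: contraTneq xy => ->; rewrite adj_irrefl.
Qed.

Lemma minor_free_clique (G H : sgraph) (Q : {set G}) :
  minor_free H G -> clique Q -> #|Q| < #|H|.
Proof.
move=> fG cQ; rewrite ltnNge; apply/negP => /(clique_subgraph cQ) sHG.
by apply: fG; apply: subgraph_minor.
Qed.

Lemma minor_free_sub (G K H : sgraph) :
  has_minor G K -> minor_free H G -> minor_free H K.
Proof. by move=> GK fG KH; apply: fG; apply: has_minor_trans KH. Qed.

(** Edges are added as long as the graph stays H-free, which must end since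
    the number of darts is bounded. The vertex type is kept, so the two graphs
    can be compared edge by edge. *)
Lemma edge_maximal_extension (H G : sgraph) :
  minor_free H G ->
  exists r : rel G, exists (rs : symmetric r) (ri : irreflexive r),
    edge_maximal_free H (SGraph rs ri) /\ subrel adj r.
Proof.
case: G => V r rs ri /=.
have [n] := ubnP (#|{: V * V}| - darts r).
elim: n => // n IHn in r rs ri *; rewrite ltnS => len fG.
have [[x [y [nxy nadj fxy]]]|max] := pselect (exists x y : SGraph rs ri,
    [/\ x != y, ~~ adj x y & minor_free H (add_edge x y)]).
  have [|//|r' [rs' [ri' [mr' sr]]]] := IHn _
    (@add_edge_sym (SGraph rs ri) x y) (@add_edge_irrefl (SGraph rs ri) x y).
    rewrite /= !dartsE in len *; apply: leq_trans len.
    have ltr : [set p : V * V | r p.1 p.2] \proper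
        [set p : V * V | @add_edge_rel (SGraph rs ri) x y p.1 p.2].
      apply/properP; split.
        by apply/subsetP=> p; rewrite !inE /add_edge_rel /= => ->.
      by exists (x, y); rewrite !inE /add_edge_rel /= ?nxy ?eqxx ?orbT.
    apply: ltn_sub2l (proper_card ltr).
    by apply: leq_trans (proper_card ltr) _; apply: max_card.
  exists r', rs', ri'; split=> // u v uv; apply: sr.
  by rewrite /add_edge_rel /= uv.
exists r, rs, ri; split=> //; split=> // x y nxy nadj.
by apply: contrapT => fxy; apply: max; exists x, y.
Qed.

(** * Disjoint unions *)

(** The branch sets may be read in K because K has all the edges of G between
    the vertices that they use. *)
Lemma model_pullback (K G H : sgraph) (i : K -> G) (B : H -> {set G}) :
  (forall a b, adj (i a) (i b) -> adj a b) -> injective i ->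
  minor_model B -> (forall u x, x \in B u -> exists a, x = i a) ->
  has_model K H.
Proof.
move=> iadj injI mB im.
have memB u a : (a \in [set a | i a \in B u]) = (i a \in B u) by rewrite inE.
exists (fun u => [set a | i a \in B u]); split.
- move=> u; have /set0Pn[x xu] := model_neq0 mB u.
  have [a xa] := im _ _ xu.
  by apply/set0Pn; exists a; rewrite memB -xa.
- move=> u a b; rewrite !memB => au bu.
  have /(connect_invariant (P := fun z =>
    exists2 c, z = i c & connect (set_adj [set a | i a \in B u]) a c)) H1 :=
      model_connected mB u _ _ au bu.
  have [| |c /injI <- //] := H1; last by exists a.
  move=> _ y [c -> ac] /and3P[cu yu cy].
  have [d yd] := im _ _ yu; exists d => //; apply: connect_trans ac _.
  by apply: connect1; rewrite /set_adj /= !inE cu -yd yu /=; apply: iadj; rewrite -yd.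
- by move=> u v a; rewrite !memB; apply: (model_disjoint mB).
- move=> u v /(model_adj mB)[x [y [xu yv xy]]].
  have [a xa] := im _ _ xu; have [b yb] := im _ _ yv; subst x y.
  by exists a, b; rewrite !memB; split=> //; apply: iadj.
Qed.

Section DisjointUnion.
Variables G1 G2 : sgraph.

Definition dunion_rel : rel (G1 + G2) := fun x y =>
  match x, y with
  | inl a, inl b => adj a b
  | inr a, inr b => adj a b
  | _, _ => false
  end.

Lemma dunion_sym : symmetric dunion_rel.
Proof. by case=> x [] y //=; rewrite adj_sym. Qed.

Lemma dunion_irrefl : irreflexive dunion_rel.
Proof. by case=> x /=; rewrite adj_irrefl. Qed.

Definition dunion : sgraph := SGraph dunion_sym dunion_irrefl.

(** Each branch set is connected, hence lies on one side, and so do those of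
    adjacent vertices; as H is connected, the whole model lives on one side. *)
Lemma dunion_free (H : sgraph) :
  0 < #|H| -> graph_connected H ->
  minor_free H G1 -> minor_free H G2 -> minor_free H dunion.
Proof.
move=> /card_gt0P[u0 _] cH f1 f2 /has_minorP[B mB].
pose side (x : G1 + G2) := if x is inl _ then true else false.
have side_adj (x y : dunion) : adj x y -> side x = side y by case: x y => x [].
have [x0 x0u] := set0Pn _ (model_neq0 mB u0).
have sideB u x y : x \in B u -> y \in B u -> side y = side x.
  move=> xu yu.
  apply: (connect_invariant (P := fun z : dunion => side z = side x))
    (model_connected mB u _ _ xu yu) _ => //.
  by move=> a b <- /and3P[_ _ /side_adj].
have all_side u x : x \in B u -> side x = side x0.
  move: x; apply: (connect_invariant (P := fun u => forall x, x \in B u ->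
    side x = side x0)) (cH u0 u) _ => [v w IH|x xu]; last exact: sideB xu.
  move=> /(model_adj mB)[a [b [av bw /side_adj ab]]] x xw.
  by rewrite (sideB _ _ _ bw xw) -ab; apply: IH.
case: x0 => x0 in x0u all_side.
- apply: f1; apply/has_minorP.
  apply: (@model_pullback G1 dunion H inl) mB _ => //; first by move=> a b [].
  by move=> u [x|x] /all_side // _; exists x.
- apply: f2; apply/has_minorP.
  apply: (@model_pullback G2 dunion H inr) mB _ => //; first by move=> a b [].
  by move=> u [x|x] /all_side // _; exists x.
Qed.

End DisjointUnion.

Section Attach.
Variables (H G G' : sgraph) (i : G -> G').
Hypotheses (maxG : edge_maximal_free H G) (freeG' : minor_free H G').
Hypotheses (injI : injective i) (homI : forall a b, adj a b -> adj (i a) (i b)).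

(** A new edge between two vertices of G would give a copy of G plus an edge,
    which has a minor H by maximality. *)
Lemma edge_maximal_induced a b : adj (i a) (i b) = adj a b.
Proof.
apply/idP/idP => [iab|]; last exact: homI.
apply: contraT => nab; exfalso; apply: freeG'.
have neq_ab : a != b by have := adj_neq iab; rewrite (inj_eq injI).
apply: has_minor_trans (proj2 maxG _ _ neq_ab nab).
apply: subgraph_minor; exists i => // x y /orP[/homI //|/andP[_]].
by case/orP=> /andP[/eqP-> /eqP->] //; rewrite adj_sym.
Qed.

(** Contracting the connected set D onto a creates the edge ab, so G plus ab,
    which has a minor H when a and b are not adjacent, would be a minor of G'. *)
Lemma edge_maximal_attachment (D : {set G'}) (a b : G) (p q : G') :
  connected_in D -> (forall c, i c \notin D) ->
  p \in D -> q \in D -> adj (i a) p -> adj (i b) q -> a != b -> adj a b.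
Proof.
move=> cD iD pD qD ap bq neq_ab; apply: contraT => nab.
exfalso; apply: freeG'; apply: has_minor_trans (proj2 maxG _ _ neq_ab nab).
apply/has_minorP.
exists (fun v : add_edge a b => if v == a then i a |: D else [set i v]).
have in_i (v : G) : i v \in (if v == a then i a |: D else [set i v]).
  by case: eqP => [->|_]; rewrite !inE eqxx.
split.
- by move=> u; apply/set0Pn; exists (i u).
- move=> u; case: eqP => _; last exact: connected_in1.
  have ip y : y \in D -> connect (set_adj (i a |: D)) (i a) y.
    move=> yD; apply: (@connect_trans _ _ p).
      by apply: connect1; rewrite /set_adj /= !inE eqxx pD orbT.
    by apply: connect_sub_set (subsetUr _ _) _; apply: cD.
  move=> x y /setU1P[->|xD] /setU1P[->|yD] //; first exact: ip.
    by rewrite (sym_connect_sym (@set_adj_sym _ _)); apply: ip.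
  by apply: connect_sub_set (subsetUr _ _) _; apply: cD.
- have inB (u : G) x : x \in (if u == a then i a |: D else [set i u]) ->
      x = i u \/ u = a /\ x \in D.
    by case: eqP => [->|_]; [case/setU1P; [left | right] | move/set1P; left].
  move=> u v x /inB[->|[-> xD]] /inB[|[]].
  + exact: injI.
  + by rewrite (negPf (iD u)).
  + by move=> xE; rewrite xE (negPf (iD v)) in xD.
  + by move=> ->.
- move=> u v /orP[uv|/andP[_ /orP[]/andP[/eqP-> /eqP->]]].
  + by exists (i u), (i v); split; rewrite ?in_i ?homI.
  + exists q, (i b); rewrite adj_sym; split=> //.
    by rewrite eqxx inE qD orbT.
  + exists (i b), q; split=> //.
    by rewrite eqxx inE qD orbT.
Qed.

End Attach.

Lemma connected_image (G G' : sgraph) (i : G -> G') :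
  (forall a b, adj a b -> adj (i a) (i b)) -> graph_connected G ->
  connected_in [set i x | x in G].
Proof.
move=> homI cG _ _ /imsetP[x _ ->] /imsetP[y _ ->].
apply: connect_image (cG x y) => u v uv; apply: connect1.
by rewrite /set_adj /= !imset_f // homI.
Qed.


(** The key to the subadditivity of the least number of edges: by
    [edge_maximal_attachment], each part being connected, all the edges
    created between the parts join a clique of one part to a clique of the
    other. *)
Lemma edge_maximal_union (H G1 G2 : sgraph) :
  0 < #|H| -> graph_connected H ->
  edge_maximal_free H G1 -> edge_maximal_free H G2 ->
  graph_connected G1 -> graph_connected G2 ->
  exists (r : rel (G1 + G2)) (rs : symmetric r) (ri : irreflexive r)
         (Q1 : {set G1}) (Q2 : {set G2}),
    [/\ edge_maximal_free H (SGraph rs ri), clique Q1 /\ clique Q2,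
        (forall a b, r (inl a) (inl b) = adj a b),
        (forall a b, r (inr a) (inr b) = adj a b)
      & (forall a b, r (inl a) (inr b) -> (a \in Q1) && (b \in Q2))].
Proof.
move=> H0 cH max1 max2 c1 c2.
have [r [rs [ri [maxr subr]]]] :=
  edge_maximal_extension (dunion_free H0 cH (proj1 max1) (proj1 max2)).
have inlI : injective (inl : G1 -> SGraph rs ri) by move=> a b [].
have inrI : injective (inr : G2 -> SGraph rs ri) by move=> a b [].
have hom1 (a b : G1) : adj a b -> @adj (SGraph rs ri) (inl a) (inl b).
  by move=> ab; apply: subr.
have hom2 (a b : G2) : adj a b -> @adj (SGraph rs ri) (inr a) (inr b).
  by move=> ab; apply: subr.
exists r, rs, ri, [set a | [exists b, r (inl a) (inr b)]],
  [set b | [exists a, r (inl a) (inr b)]]; split=> //.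
- split=> x y; rewrite !inE => /existsP[p xp] /existsP[q yq].
    apply: (edge_maximal_attachment max1 (proj1 maxr) inlI hom1
      (connected_image hom2 c2) _ _ _ xp yq); rewrite ?imset_f // => c.
    by apply/imsetP=> -[].
  apply: (edge_maximal_attachment max2 (proj1 maxr) inrI hom2
    (connected_image hom1 c1) (p := inl p) (q := inl q));
    rewrite ?imset_f //= 1?rs // => c.
  by apply/imsetP=> -[].
- exact: (edge_maximal_induced max1 (proj1 maxr) inlI hom1).
- exact: (edge_maximal_induced max2 (proj1 maxr) inrI hom2).
- move=> a b ab; rewrite !inE; apply/andP; split; apply/existsP;
    [by exists b | by exists a].
Qed.

Lemma darts_sum (T1 T2 : finType) (r : rel (T1 + T2)) :
  darts r = darts (fun a b => r (inl a) (inl b)) +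
    darts (fun a b => r (inr a) (inr b)) +
    (\sum_a \sum_b r (inl a) (inr b) + \sum_b \sum_a r (inr b) (inl a)).
Proof.
rewrite /darts big_sumType /=.
under eq_bigr do rewrite big_sumType /=.
under [X in _ + X]eq_bigr do rewrite big_sumType /=.
by rewrite !big_split /=; lia.
Qed.

Lemma sum_rel_le_setX (T1 T2 : finType) (r : T1 -> T2 -> bool)
    (A : {set T1}) (B : {set T2}) :
  (forall a b, r a b -> (a \in A) && (b \in B)) ->
  \sum_a \sum_b r a b <= #|A| * #|B|.
Proof.
move=> rAB; rewrite pair_bigA /= -cardsX -sum1_card [leqRHS]big_mkcond /=.
apply: leq_sum => -[a b] _ /=; rewrite inE /=.
by case: (boolP (r a b)) => // /rAB->.
Qed.

Lemma num_edges_union_ge (G1 G2 : sgraph) (r : rel (G1 + G2))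
    (rs : symmetric r) (ri : irreflexive r) :
  (forall a b, r (inl a) (inl b) = adj a b) ->
  (forall a b, r (inr a) (inr b) = adj a b) ->
  num_edges G1 + num_edges G2 <= num_edges (SGraph rs ri).
Proof.
move=> r1 r2; rewrite -leq_double doubleD -!darts_double darts_sum /=.
apply: leq_trans (leq_addr _ _); rewrite eq_leq //; congr (_ + _);
  by apply: eq_bigr => x _; apply: eq_bigr => y _; rewrite ?r1 ?r2.
Qed.

Lemma num_edges_union_le (G1 G2 : sgraph) (r : rel (G1 + G2))
    (rs : symmetric r) (ri : irreflexive r) (Q1 : {set G1}) (Q2 : {set G2}) :
  (forall a b, r (inl a) (inl b) = adj a b) ->
  (forall a b, r (inr a) (inr b) = adj a b) ->
  (forall a b, r (inl a) (inr b) -> (a \in Q1) && (b \in Q2)) ->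
  num_edges (SGraph rs ri) <= num_edges G1 + num_edges G2 + #|Q1| * #|Q2|.
Proof.
move=> r1 r2 r12; rewrite -leq_double !doubleD -!darts_double darts_sum /=.
rewrite -addnn; apply: leq_add.
  rewrite eq_leq //; congr (_ + _);
  by apply: eq_bigr => x _; apply: eq_bigr => y _; rewrite ?r1 ?r2.
apply: leq_add; first exact: sum_rel_le_setX.
rewrite exchange_big; apply: sum_rel_le_setX => a b.
by rewrite rs; apply: r12.
Qed.

(** * Two-connected graphs *)

Lemma bigminn_le (I : finType) (P : pred I) (F : I -> nat) d i :
  P i -> \big[minn/d]_(j | P j) F j <= F i.
Proof.
have: i \in index_enum I by rewrite mem_index_enum.
elim: (index_enum I) => // j s IHs; rewrite inE big_cons => /orP[/eqP<- ->|].
  exact: geq_minl.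
move=> /IHs IH /IH; case: (P j) => //; apply: leq_trans.
exact: geq_minr.
Qed.

Lemma vertex_cutPn (H : sgraph) (S : {set H}) :
  ~~ vertex_cut S -> forall x y, x \notin S -> y \notin S ->
  connect [rel u v | [&& u \notin S, v \notin S & adj u v]] x y.
Proof.
move=> ncut x y xS yS; apply: contraNT ncut => nxy.
by apply/existsP; exists x; apply/existsP; exists y; rewrite xS yS.
Qed.

Section TwoConnected.
Variable H : sgraph.
Hypothesis H2 : two_connected H.

Lemma two_connected_cut (S : {set H}) : #|S| <= 1 -> ~~ vertex_cut S.
Proof.
move=> S1; apply/negP => cutS.
move: H2; rewrite /two_connected /connectivity; case: ifPn => [/forallP cH _|_].
  move/existsP: cutS => [x /existsP[y /and3P[xS yS]]].
  case/negP; have [->//|nxy] := eqVneq x y.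
  apply: connect1; rewrite /= xS yS.
  by move/forallP/(_ y)/implyP: (cH x); apply.
move=> /leq_trans/(_ (bigminn_le _ _ cutS)).
by rewrite leqNgt ltnS S1.
Qed.

Lemma two_connected_card : 2 < #|H|.
Proof.
move: H2; rewrite /two_connected /connectivity; case: ifPn => [_|]; first lia.
case/forallPn=> x /forallPn[y]; rewrite negb_imply => /andP[nxy nadj].
have cutS : vertex_cut (~: [set x; y]).
  apply/existsP; exists x; apply/existsP; exists y; rewrite !inE !negbK.
  rewrite !eqxx orbT /=; apply/negP => cxy.
  have := connect_invariant (P := fun z => z = x) _ cxy (erefl x).
  move=> yx; rewrite yx ?eqxx // in nxy => {yx} u v -> /and3P[_].
  by rewrite !inE negbK => /orP[]/eqP-> // xy; rewrite xy in nadj.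
move=> /leq_trans/(_ (bigminn_le _ _ cutS)).
by have := cardsC [set x; y]; rewrite cards2 nxy; lia.
Qed.

Lemma two_connected_connected : graph_connected H.
Proof.
move=> x y; have := @two_connected_cut set0.
rewrite cards0 => /(_ isT)/vertex_cutPn/(_ x y).
rewrite !inE => /(_ isT isT); apply: connect_sub => u v /and3P[_ _].
exact: connect1.
Qed.

(** The neighbours of a vertex of degree at most 1 would form a vertex cut
    with at most one vertex. *)
Lemma two_connected_degree (v : H) : 1 < #|nbrs v|.
Proof.
rewrite ltnNge; apply/negP => dv; have /vertex_cutPn cut := two_connected_cut dv.
have [z zv] : exists z, z \notin v |: nbrs v.
  apply/existsP; rewrite -negb_forall; apply/negP => /forallP allv.
  have := two_connected_card; rewrite ltnNge; case/negP.
  rewrite -cardsT (leq_trans (subset_leq_card (B := v |: nbrs v) _)) //.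
    by apply/subsetP=> z _; apply: allv.
  by rewrite cardsU1; lia.
move: zv; rewrite !inE negb_or => /andP[zv nvz].
have := cut v z; rewrite !inE adj_irrefl => /(_ isT nvz) cvz.
have zE := connect_invariant (P := fun u => u = v) _ cvz (erefl v).
rewrite zE ?eqxx // in zv => u w -> /and3P[_].
by rewrite inE => /negPf->.
Qed.

Lemma two_connected_edge : exists u v : H, adj u v.
Proof.
have /card_gt0P[u _] : 0 < #|H| by have := two_connected_card; lia.
have /card_gt0P[v] : 0 < #|nbrs u| by have := two_connected_degree u; lia.
by rewrite inE; exists u, v.
Qed.

End TwoConnected.

Lemma two_connected_card_gt0 (H : sgraph) : two_connected H -> 0 < #|H|.
Proof. by move/two_connected_card; lia. Qed.


(** Here xy is the only edge that leaves D, and all branch sets meet D. A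
    branch set that also leaves D does so through x; collapsing the other side
    onto x shows that its trace on D stays connected. At most one branch set
    contains x, so the edges between branch sets survive. *)
Lemma model_bridge_side (H G : sgraph) (r : rel G) (rs : symmetric r)
    (ri : irreflexive r) (x y : G) (D : {set G}) (B : H -> {set SGraph rs ri}) :
  (forall a b, r a b -> a \in D -> b \notin D -> a = x /\ b = y) ->
  (forall a b, r a b -> a \in D -> b \in D -> adj a b) ->
  minor_model B -> (forall v, exists2 z, z \in B v & z \in D) ->
  has_model G H.
Proof.
move=> cross adjD mB meetD.
have xB v z : z \in B v -> z \notin D -> x \in B v.
  move=> zv zD; have [w wv wD] := meetD v.
  apply: contraT => xv.
  suff : z \in D by rewrite (negPf zD).
  apply: (connect_invariant (P := fun z => z \in D))
    (model_connected mB v _ _ wv zv) wD => a b aD /and3P[av bv ab].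
  apply: contraT => bD; have [ax _] := cross _ _ ab aD bD.
  by rewrite -ax av in xv.
exists (fun v => B v :&: D); split.
- by move=> v; have [z zv zD] := meetD v; apply/set0Pn; exists z; rewrite inE zv.
- move=> v a b /setIP[av aD] /setIP[bv bD].
  (* Collapse of the far side of the bridge. *)
  pose f (z : G) : G := if z \in D then z else x.
  have [<- <-] : f a = a /\ f b = b by rewrite /f aD bD.
  apply: connect_image (model_connected mB v _ _ av bv) => c d /and3P[cv dv cd].
  rewrite /f; case: (boolP (c \in D)) (boolP (d \in D)) => cD [] dD //.
  + by apply: connect1; rewrite /set_adj /= !inE cv cD dv dD; apply: adjD.
  + by have [-> _] := cross _ _ cd cD dD.
  + by rewrite adj_sym in cd; have [-> _] := cross _ _ cd dD cD.
- by move=> u v z /setIP[zu _] /setIP[zv _]; apply: (model_disjoint mB zu zv).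
- move=> u v uv; have [a [b [au bv ab]]] := model_adj mB uv.
  have neq_uv := adj_neq uv.
  case: (boolP (a \in D)) (boolP (b \in D)) => aD [] bD.
  + by exists a, b; rewrite !inE au bv; split=> //; apply: adjD.
  + have [ax _] := cross _ _ ab aD bD; rewrite ax in au.
    by rewrite (model_disjoint mB au (xB _ _ bv bD)) eqxx in neq_uv.
  + rewrite adj_sym in ab; have [bx _] := cross _ _ ab bD aD; rewrite bx in bv.
    by rewrite (model_disjoint mB (xB _ _ au aD) bv) eqxx in neq_uv.
  + by rewrite (model_disjoint mB (xB _ _ au aD) (xB _ _ bv bD)) eqxx in neq_uv.
Qed.

(** If x and y lay in different components, adding xy would create a model of
    H in which xy is a bridge. If all branch sets met the same side of the
    bridge, the model would restrict to that side. Otherwise some branch set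
    lies on each side; since H minus the vertex whose branch set contains x is
    connected, the branch sets of its other vertices all avoid the component D
    of x. The branch set inside D must then be the one that contains x, and
    all its neighbours contain y, so its vertex has degree at most 1 in H. *)
Lemma edge_maximal_connected (H G : sgraph) :
  two_connected H -> edge_maximal_free H G -> graph_connected G.
Proof.
move=> H2 [freeG maxG] x y; apply: contraT => nxy; exfalso; apply: freeG.
pose D := [set z | connect adj x z].
have closedD a b : adj a b -> (a \in D) = (b \in D).
  move=> ab; rewrite !inE; apply/idP/idP => /connect_trans; apply.
    exact: connect1.
  by apply: connect1; rewrite adj_sym.
have xD : x \in D by rewrite inE connect0.
have yD : y \notin D by rewrite inE.
have neq_xy : x != y by apply: contraNneq nxy => ->.
have nadj : ~~ adj x y by apply: contraNN nxy => /connect1.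
have /has_minorP[B mB] := maxG _ _ neq_xy nadj.
have cross (a b : add_edge x y) : adj a b -> a \in D -> b \notin D -> a = x /\ b = y.
  move=> /orP[/closedD-> -> //|/andP[_ /orP[]/andP[/eqP-> /eqP->]//]].
  by rewrite (negPf yD).
have same_side (a b : add_edge x y) :
    adj a b -> (a \in D) = (b \in D) -> @adj G a b.
  by move=> /orP[//|/andP[_ /orP[]/andP[/eqP-> /eqP->]]]; rewrite xD (negPf yD).
apply/has_minorP.
have [meetD|] := pselect (forall v, exists2 z, z \in B v & z \in D).
  apply: (model_bridge_side (x := x) (y := y)) mB meetD => // a b ab aD bD.
  by apply: same_side; rewrite // aD bD.
have [meetC _|] := pselect (forall v, exists2 z, z \in B v & z \in ~: D).
  apply: (model_bridge_side (x := y) (y := x)) mB meetC => // a b ab.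
    rewrite !inE negbK => aD bD; have ba : @adj (add_edge x y) b a by rewrite adj_sym.
    by have [] := cross b a ba; rewrite ?inE.
  by move=> /setCP/negP/negPf aD /setCP/negP/negPf bD; apply: same_side; rewrite // aD bD.
move=> /existsNP[w wD] /existsNP[u uC]; exfalso.
have {}wD z : z \in B w -> z \in D.
  by move=> zw; apply: contraT => zD; case: wD; exists z => //; rewrite inE.
have {}uC z : z \in B u -> z \notin D.
  by move=> zu; apply/negP => zD; case: uC; exists z.
pose T := [set t | x \in B t].
(* T has at most one element, the vertex whose branch set contains x. *)
have cutT : ~~ vertex_cut T.
  apply: two_connected_cut => //; rewrite leqNgt; apply/card_gt1P => -[s [t [+ + st]]].
  by rewrite !inE => sx tx; rewrite (model_disjoint mB sx tx) eqxx in st.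
have inD v : v \notin T -> forall z z', z \in B v -> z' \in B v -> z \in D -> z' \in D.
  rewrite inE => xv z z' zv z'v.
  apply: (connect_invariant (P := fun z => z \in D))
    (model_connected mB v _ _ zv z'v) => a b aD /and3P[av bv ab].
  apply: contraT => bD; have [ax _] := cross _ _ ab aD bD.
  by rewrite -ax av in xv.
have uT : u \notin T by rewrite inE; apply/negP => /uC; rewrite xD.
have offD v : v \notin T -> forall z, z \in B v -> z \notin D.
  move=> vT z zv; apply/negP => zD.
  have vu := vertex_cutPn cutT vT uT.
  have [z0 z0u] := set0Pn _ (model_neq0 mB u).
  have /negP := uC _ z0u; apply.
  apply: (connect_invariant (P := fun v => forall z, z \in B v -> z \in D)) vu _ _ z0u;
    last by move=> z' z'v; apply: inD zv z'v zD.
  move=> s t IHs /and3P[sT tT /(model_adj mB)[a [b [as_ bt ab]]]] z' z't.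
  apply: (inD _ tT b) => //; apply: contraT => bD.
  have [ax _] := cross _ _ ab (IHs _ as_) bD.
  by rewrite inE -ax as_ in sT.
have wT : w \in T.
  have [z zw] := set0Pn _ (model_neq0 mB w).
  by apply: contraT => /offD/(_ z zw); rewrite wD.
have yB v : v \in nbrs w -> y \in B v.
  rewrite inE => wv; have [a [b [aw bv ab]]] := model_adj mB wv.
  have vT : v \notin T.
    rewrite inE; apply/negP => xv; rewrite inE in wT.
    by have := adj_neq wv; rewrite (model_disjoint mB wT xv) eqxx.
  by have [_ <-] := cross _ _ ab (wD _ aw) (offD _ vT _ bv).
have /card_gt1P[s [t [sw tw]]] := two_connected_degree H2 w.
by rewrite (model_disjoint mB (yB _ sw) (yB _ tw)) eqxx.
Qed.

(** * The gap is superadditive up to a constant *)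

Lemma bigminn_attained (I : finType) (P : pred I) (F : I -> nat) d :
  \big[minn/d]_(j | P j) F j = d \/
  exists2 i, P i & \big[minn/d]_(j | P j) F j = F i.
Proof.
elim/big_rec: _ => [|i x Pi [->|[j Pj ->]]]; first by left.
- by rewrite /minn; case: ifP => _; [right; exists i | left].
- by right; rewrite /minn; case: ifP => _; [exists i | exists j].
Qed.

Section GapTwoConnected.
Variable H : sgraph.
Hypothesis H2 : two_connected H.

Lemma edge_maximal_counts (G : sgraph) :
  edge_maximal_free H G -> edge_counts H #|G| (num_edges G).
Proof. by move=> maxG; exists G. Qed.

Lemma edge_counts_bound n m : edge_counts H n m -> m < 'C(n, 2).+1.
Proof. by case=> G [<- _ <-]; rewrite ltnS num_edges_le_bin. Qed.

Lemma max_edges_maximal (G : sgraph) :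
  edge_maximal_free H G -> num_edges G <= max_edges H #|G|.
Proof.
move=> /edge_maximal_counts cG; have lt := edge_counts_bound cG.
by apply: (@leq_bigmax_cond _ _ _ (Ordinal lt)); apply/asboolP.
Qed.

Lemma min_edges_maximal (G : sgraph) :
  edge_maximal_free H G -> min_edges H #|G| <= num_edges G.
Proof.
move=> /edge_maximal_counts cG; have lt := edge_counts_bound cG.
by apply: (@bigminn_le _ _ _ _ (Ordinal lt)); apply/asboolP.
Qed.

Lemma max_edges_free (G : sgraph) :
  minor_free H G -> num_edges G <= max_edges H #|G|.
Proof.
move=> /edge_maximal_extension[r [rs [ri [maxr sr]]]].
apply: leq_trans (max_edges_maximal maxr).
by rewrite -leq_double -!darts_double; apply: leq_darts.
Qed.

Lemma edge_maximal_exists n :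
  exists2 G : sgraph, #|G| = n & edge_maximal_free H G.
Proof.
pose r : rel 'I_n := fun _ _ => false.
have rs : symmetric r by [].
have ri : irreflexive r by [].
have fr : minor_free H (SGraph rs ri).
  move=> /has_minorP[B mB]; have [u [v uv]] := two_connected_edge H2.
  by have [x [y []]] := model_adj mB uv.
have [r' [rs' [ri' [maxr _]]]] := edge_maximal_extension fr.
by exists (SGraph rs' ri'); rewrite ?card_ord.
Qed.

Lemma max_edges_attained n : exists G : sgraph,
  [/\ #|G| = n, edge_maximal_free H G & num_edges G = max_edges H n].
Proof.
have [G Gn maxG] := edge_maximal_exists n.
have cG := edge_maximal_counts maxG; rewrite Gn in cG.
have lt := edge_counts_bound cG.
have [|i + iE] := @eq_bigmax_cond _
    (fun m : 'I_('C(n, 2).+1) => `[< edge_counts H n m >]) (@nat_of_ord _).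
  by apply/card_gt0P; exists (Ordinal lt); apply/asboolP.
by move/asboolP => [K [Kn maxK KE]]; exists K; rewrite KE -iE.
Qed.

Lemma min_edges_attained n : exists G : sgraph,
  [/\ #|G| = n, edge_maximal_free H G & num_edges G = min_edges H n].
Proof.
have [E|[i /asboolP[K [Kn maxK KE]] E]] := @bigminn_attained 'I_('C(n, 2).+1)
    (fun m => `[< edge_counts H n m >]) (@nat_of_ord _) 'C(n, 2); last first.
  by exists K; rewrite KE -E.
have [G Gn maxG] := edge_maximal_exists n; exists G; split=> //.
apply/eqP; rewrite eqn_leq -{2}Gn min_edges_maximal // andbT.
by rewrite [leqRHS]E -Gn num_edges_le_bin.
Qed.

Lemma min_le_max_edges n : min_edges H n <= max_edges H n.
Proof.
have [G [Gn maxG <-]] := max_edges_attained n.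
by rewrite -Gn min_edges_maximal.
Qed.

Lemma max_edges_add a b : max_edges H a + max_edges H b <= max_edges H (a + b).
Proof.
have [G1 [<- max1 <-]] := max_edges_attained a.
have [G2 [<- max2 <-]] := max_edges_attained b.
have fG := dunion_free (two_connected_card_gt0 H2) (two_connected_connected H2)
  (proj1 max1) (proj1 max2).
have := max_edges_free fG; rewrite card_sum; apply: leq_trans.
exact: num_edges_union_ge.
Qed.

(** By [edge_maximal_union] the number of edges created is at most the product
    of the sizes of two cliques, and a clique of an H-free graph has fewer
    than |H| vertices. *)
Lemma min_edges_add a b :
  min_edges H (a + b) <= min_edges H a + min_edges H b + #|H| ^ 2.
Proof.
have [G1 [<- max1 <-]] := min_edges_attained a.
have [G2 [<- max2 <-]] := min_edges_attained b.
have [r [rs [ri [Q1 [Q2 [maxr [c1 c2] r1 r2 r12]]]]]] :=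
  edge_maximal_union (two_connected_card_gt0 H2) (two_connected_connected H2)
    max1 max2 (edge_maximal_connected H2 max1) (edge_maximal_connected H2 max2).
have := min_edges_maximal maxr; rewrite card_sum => /leq_trans; apply.
apply: leq_trans (num_edges_union_le rs ri r1 r2 r12) _.
rewrite leq_add2l -mulnn.
by rewrite leq_mul // ltnW //; apply: (minor_free_clique (proj1 _)); eauto.
Qed.

(** Superadditivity of the maximum, and subadditivity of the minimum up to
    |H|^2. *)
Lemma gap_add a b : gap H a + gap H b <= gap H (a + b) + #|H| ^ 2.
Proof.
have := min_edges_add a b; have := max_edges_add a b; rewrite /gap.
have := min_le_max_edges a; have := min_le_max_edges b.
have := min_le_max_edges (a + b); lia.
Qed.

End GapTwoConnected.

(** * A linear bound on the number of edges *)

Section Cone.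
Variable G : sgraph.

Definition cone_rel : rel (option G) := fun x y =>
  match x, y with
  | Some a, Some b => adj a b
  | None, None => false
  | _, _ => true
  end.

Lemma cone_sym : symmetric cone_rel.
Proof. by case=> [x|] [y|] //=; rewrite adj_sym. Qed.

Lemma cone_irrefl : irreflexive cone_rel.
Proof. by case=> [x|] //=; rewrite adj_irrefl. Qed.

Definition cone : sgraph := SGraph cone_sym cone_irrefl.
End Cone.

(** The new vertex of H gets the new vertex of G as its branch set. *)
Lemma cone_model (G H : sgraph) : has_model G H -> has_model (cone G) (cone H).
Proof.
case=> B mB.
pose C (u : cone H) : {set cone G} :=
  if u is Some v then Some @: B v else [set None].
have SomeI : injective (@Some G) by move=> a b [].
have memS v x : (Some x \in Some @: B v) = (x \in B v) := mem_imset _ _ SomeI.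
have memN v : (None \in Some @: B v) = false by apply/imsetP=> -[].
exists C; split.
- case=> [v|] /=; last by apply/set0Pn; exists None; rewrite set11.
  have [x xv] := set0Pn _ (model_neq0 mB v).
  by apply/set0Pn; exists (Some x); rewrite memS.
- case=> [v|] /=; last exact: connected_in1.
  move=> [x|] [y|]; rewrite ?memN // !memS => xv yv.
  apply: connect_image (model_connected mB v _ _ xv yv) => a b /and3P[av bv ab].
  by apply: connect1; rewrite /set_adj /= !memS av bv.
- move=> [u|] [v|] [x|] //=; rewrite ?memS ?memN ?inE //.
  by move=> xu xv; rewrite (model_disjoint mB xu xv).
- move=> [u|] [v|] //= uv.
  + have [x [y [xu yv xy]]] := model_adj mB uv.
    by exists (Some x), (Some y); rewrite !memS.
  + have [x xu] := set0Pn _ (model_neq0 mB u).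
    by exists (Some x), None; rewrite memS set11.
  + have [x xv] := set0Pn _ (model_neq0 mB v).
    by exists None, (Some x); rewrite memS set11.
Qed.

Lemma complete_cone n : isomorphic (cone (complete_graph n)) (complete_graph n.+1).
Proof.
exists (fun u : option 'I_n => if u is Some i then lift ord0 i else ord0).
  exists (unlift ord0); first by case=> [i|]; rewrite ?liftK ?unlift_none.
  by move=> i; case: unliftP => [j ->|->].
case=> [i|] [j|] //=; rewrite ?eqxx //.
Qed.

Definition induced (G : sgraph) (S : {set G}) : sgraph :=
  @SGraph {x : G | x \in S} (fun x y => adj (val x) (val y))
    (fun x y => adj_sym (val x) (val y)) (fun x => adj_irrefl (val x)).

Lemma induced_subgraph (G : sgraph) (S : {set G}) : subgraph (induced S) G.
Proof. by exists val => //; apply: val_inj. Qed.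

Lemma card_induced (G : sgraph) (S : {set G}) : #|induced S| = #|S|.
Proof. exact: card_sig. Qed.

Lemma darts_induced (G : sgraph) (S : {set G}) :
  darts (@adj (induced S)) = \sum_(x in S) \sum_(y in S) adj x y.
Proof.
rewrite /darts [RHS]big_sub; apply: eq_bigr => x _.
by rewrite [RHS]big_sub.
Qed.

Lemma sum_adj (G : sgraph) (S : {set G}) (x : G) :
  \sum_(y in S) adj x y = #|nbrs x :&: S|.
Proof.
rewrite -sum1_card [LHS]big_mkcond [RHS]big_mkcond /=.
by apply: eq_bigr => y _; rewrite !inE andbC; case: (y \in S) (adj x y) => [] [].
Qed.

(** Contracting xy loses the edge xy itself and merges the two edges to each
    common neighbour. Formally, replacing y by x is injective on the darts
    that remain after deleting xy and the darts between y and common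
    neighbours. *)
Lemma num_edges_contract (G : sgraph) (x y : G) : adj x y ->
  num_edges G <= num_edges (contract x y) + #|nbrs x :&: nbrs y|.+1.
Proof.
move=> xy; rewrite -leq_double doubleD -!darts_double !dartsE.
have nxy := adj_neq xy.
pose x' : contract x y := Sub x nxy.
pose pr p : contract x y := insubd x' p.
have val_pr p : val (pr p) = if p == y then x else p.
  by rewrite /pr val_insubd; case: eqP.
set C := nbrs x :&: nbrs y; set D := [set p | _].
pose R := [set (x, y); (y, x)] :|: (setX [set y] C :|: setX C [set y]).
have cardR : #|R| <= #|C|.+1.*2.
  rewrite (leq_trans (leq_card_setU _ _)) // cards2 xpair_eqE negb_and nxy /=.
  rewrite doubleS !addSn add0n !ltnS (leq_trans (leq_card_setU _ _)) //.
  by rewrite !cardsX cards1 mul1n muln1 addnn.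
rewrite -(cardsID R D) addnC leq_add //; last first.
  exact: leq_trans (subset_leq_card (subsetIr _ _)) cardR.
pose f (p : G * G) : contract x y * contract x y := (pr p.1, pr p.2).
have DRP a b : reflect [/\ adj a b, a = x -> b <> y, a = y -> b <> x,
    a = y -> b \notin C & b = y -> a \notin C] ((a, b) \in D :\: R).
  rewrite in_setD !in_setU !in_setX !in_set1 [_ \in D]inE /= !xpair_eqE.
  rewrite !negb_or; apply: (iffP idP).
    case/andP=> /andP[/andP[n1 n2] /andP[n3 n4]] ab; split=> //.
    + by move=> ax yb; rewrite ax yb !eqxx in n1.
    + by move=> ay bx; rewrite ay bx !eqxx in n2.
    + by move=> ay; rewrite ay eqxx in n3.
    + by move=> by_; rewrite by_ eqxx andbT in n4.
  case=> -> n1 n2 n3 n4; rewrite andbT; apply/andP; split; apply/andP; split.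
  + by apply/negP => /andP[/eqP/n1 + /eqP].
  + by apply/negP => /andP[/eqP/n2 + /eqP].
  + by apply/negP => /andP[/eqP/n3/negP].
  + by apply/negP => /andP[+ /eqP/n4/negP].
have DR_sym a b : (a, b) \in D :\: R -> (b, a) \in D :\: R.
  case/DRP=> ab n1 n2 n3 n4; apply/DRP; split=> //; first by rewrite adj_sym.
  + by move=> bx ay; apply: n2.
  + by move=> by_ ax; apply: n1.
have half a b a' b' : (a, b) \in D :\: R -> (a', b') \in D :\: R ->
    f (a, b) = f (a', b') -> a = y -> a' = y.
  move=> /DRP[ab _ n2 n3 _] /DRP[ab' n1' _ _ _] [].
  move=> /(congr1 val) + /(congr1 val); rewrite !val_pr => ea eb ay.
  apply/eqP; apply: contraT => nay'; move: ea.
  rewrite ay eqxx (negPf nay') => xa'; have nby' := n1' (esym xa').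
  have nby : b != y by rewrite eq_sym -ay adj_neq.
  move: eb; rewrite (negPf nby) (negPf (introN eqP nby')) => eb.
  by have := n3 ay; rewrite !inE xa' eb ab' -eb -ay ab.
have half' a b a' b' : (a, b) \in D :\: R -> (a', b') \in D :\: R ->
    f (a, b) = f (a', b') -> a = a'.
  move=> p p' e; have := e; case=> /(congr1 val) + _; rewrite !val_pr.
  case: (eqVneq a y) (eqVneq a' y) => [ay|nay] [ay'|nay'] //.
  - by rewrite ay ay'.
  - by rewrite (half _ _ _ _ p p' e ay) eqxx in nay'.
  - by rewrite (half _ _ _ _ p' p (esym e) ay') eqxx in nay.
rewrite -(card_in_imset (f := f)).
  apply: subset_leq_card; apply/subsetP=> _ /imsetP[[a b] /DRP[ab n1 n2 _ _] ->].
  rewrite inE /= /contract_rel -val_eqE !val_pr /=.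
  case: (eqVneq a y) (eqVneq b y) => [ay|nay] [by_|nby].
  - by rewrite ay by_ adj_irrefl in ab.
  - rewrite eqxx -ay ab !orbT andbT eq_sym.
    by apply/eqP; apply: n2.
  - rewrite eqxx -by_ ab !orbT andbT.
    by apply/eqP => ax; apply: (n1 ax).
  - by rewrite ab (adj_neq ab).
move=> [a b] [a' b'] p p' e; have aa' := half' _ _ _ _ p p' e.
have bb' : b = b'.
  by apply: (half' _ _ _ _ (DR_sym _ _ p) (DR_sym _ _ p')); case: e; rewrite /f /= => -> ->.
by rewrite aa' bb'.
Qed.

Lemma minor_neighbourhood_cone (G : sgraph) (x : G) (r : nat) :
  has_minor (induced (nbrs x)) (complete_graph r) ->
  has_minor G (complete_graph r.+1).
Proof.
move=> /has_minorP/cone_model/has_minorP Kr.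
have sK := isomorphic_subgraph (isomorphic_sym (complete_cone r)).
apply: has_minor_trans (subgraph_minor sK).
apply: has_minor_trans Kr; apply: subgraph_minor.
exists (fun u : option (induced (nbrs x)) => if u is Some v then val v else x).
  move=> [[u uP]|] [[v vP]|] //=.
  - by move=> uv; subst v; congr Some; apply: val_inj.
  - by move=> ux; exfalso; move: (uP); rewrite ux inE adj_irrefl.
  - by move=> ux; exfalso; move: (vP); rewrite -ux inE adj_irrefl.
move=> [[u uP]|] [[v vP]|] //= _; first by rewrite adj_sym; rewrite inE in uP.
by rewrite inE in vP.
Qed.

(** If the ends of some edge have few common neighbours, contracting it
    preserves the density. Otherwise every edge has at least 2^(r+1) common
    neighbours, so the neighbourhood of a non-isolated vertex has minimum
    degree at least 2^(r+1) and hence contains K_(r+1) as a minor by induction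
    on r; the vertex itself completes it. *)
Lemma mader (r : nat) (G : sgraph) :
  0 < #|G| -> 2 ^ r * #|G| <= num_edges G -> has_minor G (complete_graph r.+1).
Proof.
elim: r G => [|r IHr] G.
  move=> /card_gt0P[x _] _; apply: subgraph_minor; exists (fun=> x).
    by move=> i j _; rewrite !ord1.
  by move=> i j; rewrite !ord1.
have [n] := ubnP #|G|; elim: n => // n IHn in G *; rewrite ltnS => leGn G0 dense.
have [[x [y [xy small]]]|large] := pselect (exists x y : G,
    adj x y /\ #|nbrs x :&: nbrs y| < 2 ^ r.+1).
  apply: has_minor_trans (model_has_minor (contract_model xy)) _.
  have card_c : #|contract x y|.+1 = #|G|.
    by rewrite card_sig (cardC1 y) prednK.
  (* Few common neighbours: the contracted graph is as dense. *)
  have := num_edges_contract xy.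
  have : 1 < #|G|.
    by apply/card_gt1P; exists x, y; rewrite adj_neq.
  move: small leGn dense; rewrite -card_c mulnS => small leGn dense G1 le_e.
  by apply: IHn => //; lia.
have [x [y xy]] : exists x y : G, adj x y.
  have : num_edges G != 0 by rewrite -lt0n (leq_trans _ dense) // muln_gt0 expn_gt0.
  rewrite cards_eq0 => /set0Pn[E]; rewrite inE.
  by case/existsP=> x /existsP[y /andP[xy _]]; exists x, y.
apply: (@minor_neighbourhood_cone _ x); apply: IHr.
  by rewrite card_induced; apply/card_gt0P; exists y; rewrite inE.
rewrite -leq_double -darts_double darts_induced card_induced.
rewrite -mul2n mulnA -expnS mulnC -sum_nat_const; apply: leq_sum => z; rewrite inE => xz.
rewrite sum_adj setIC leqNgt; apply/negP => small.
by apply: large; exists x, z.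
Qed.

Lemma minor_free_num_edges (H G : sgraph) :
  0 < #|H| -> minor_free H G -> num_edges G <= 2 ^ #|H| * #|G|.
Proof.
move=> H0 fG; rewrite leqNgt; apply/negP => dense.
have [G0|G0] := posnP #|G|.
  have := num_edges_le_bin G; rewrite G0 bin0n leqn0 => /eqP e0.
  by rewrite e0 in dense.
apply: fG; apply: (@has_minor_trans _ (complete_graph #|H|)); last first.
  apply: subgraph_minor.
  apply: (@clique_subgraph (complete_graph #|H|) H setT) => [x y _ _ //|].
  by rewrite cardsT card_ord.
have [r rE] : exists r, #|H| = r.+1 by exists #|H|.-1; rewrite prednK.
rewrite rE; apply: mader => //; rewrite rE in dense.
by apply: leq_trans (ltnW dense); rewrite leq_mul2r leq_exp2l // leqnSn orbT.
Qed.

Lemma gap_linear (H : sgraph) n :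
  two_connected H -> gap H n <= 2 ^ #|H| * n.
Proof.
move=> H2; apply: leq_trans (leq_subr _ _) _.
have [G [<- [fG _] <-]] := max_edges_attained H2 n.
by apply: minor_free_num_edges fG; apply: two_connected_card_gt0.
Qed.

(** * Dense graphs without a given minor *)

(** A choice of representatives is an injection from A to S. *)
Lemma leq_card_representatives (T U : finType) (A : {set U})
    (P : U -> T -> Prop) (S : {set T}) :
  (forall u, u \in A -> exists2 x, x \in S & P u x) ->
  (forall u v x, P u x -> P v x -> u = v) -> #|A| <= #|S|.
Proof.
move=> exP uniqP.
have [->|[u0 u0A]] := set_0Vmem A; first by rewrite cards0.
have [x0 _ _] := exP _ u0A.
have exS u : exists x, u \in A -> x \in S /\ P u x.
  have [uA|nuA] := boolP (u \in A).
    by have [x xS Px] := exP u uA; exists x.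
  by exists x0.
have [f fP] := choice exS.
rewrite -(card_in_imset (f := f) (D := A)).
  by apply: subset_leq_card; apply/subsetP=> _ /imsetP[u /fP[fS _] ->].
move=> u v /fP[_ Pu] /fP[_ Pv] fuv; rewrite fuv in Pu.
exact: uniqP Pu Pv.
Qed.

(** The join of K_s with t disjoint copies of K_b. *)
Section JoinOfCliques.
Variables s t b : nat.

Definition clique_join_rel : rel ('I_s + 'I_t * 'I_b) := fun x y =>
  match x, y with
  | inl i, inl j => i != j
  | inr p, inr q => (p.1 == q.1) && (p.2 != q.2)
  | _, _ => true
  end.

Lemma clique_join_sym : symmetric clique_join_rel.
Proof. by case=> x [] y //=; rewrite eq_sym // [y.2 == _]eq_sym. Qed.

Lemma clique_join_irrefl : irreflexive clique_join_rel.
Proof. by case=> x /=; rewrite ?eqxx //= andbF. Qed.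

Definition clique_join : sgraph := SGraph clique_join_sym clique_join_irrefl.

Lemma card_clique_join : #|clique_join| = s + t * b.
Proof. by rewrite card_sum card_prod !card_ord. Qed.

Lemma num_edges_clique_join :
  t * b * (s.*2 + b.-1) <= (num_edges clique_join).*2.
Proof.
rewrite -darts_double darts_sum /=; set D := darts (fun a b : 'I_t * 'I_b => _).
have -> : \sum_(a : 'I_s) \sum_(p : 'I_t * 'I_b) true = s * (t * b).
  by rewrite !sum_nat_const card_prod !card_ord muln1.
have -> : \sum_(p : 'I_t * 'I_b) \sum_(a : 'I_s) true = t * b * s.
  by rewrite !sum_nat_const card_prod !card_ord muln1.
suff -> : D = t * b * b.-1 by lia.
rewrite /D /darts (eq_bigr (fun=> b.-1)) => [|[i j] _].
  by rewrite sum_nat_const card_prod !card_ord.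
rewrite -(pair_bigA _ (fun k l => nat_of_bool ((i == k) && (j != l)))) /=.
rewrite (bigD1 i) //= [X in _ + X]big1 => [|k ki]; last first.
  by rewrite big1 // => l _; rewrite eq_sym (negPf ki).
rewrite addn0 (eq_bigr (fun l => nat_of_bool (l != j))) => [|l _]; last first.
  by rewrite eqxx eq_sym.
have := sum1_card (predC1 j); rewrite cardC1 card_ord big_mkcond /= => <-.
by apply: eq_bigr => l _; rewrite inE; case: (l != j).
Qed.

(** At most s branch sets meet K_s. The other vertices of H induce a connected
    graph, so their branch sets all lie in one copy of K_b. Altogether H has
    at most s + b vertices. *)
Lemma clique_join_free (H : sgraph) :
  (forall U : {set H}, #|U| <= s -> ~~ vertex_cut U) -> s + b < #|H| ->
  minor_free H clique_join.
Proof.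
move=> cutH ltH /has_minorP[B mB].
pose U := [set u | [exists i, inl i \in B u]].
have U_s : #|U| <= s.
  rewrite -[leqRHS]card_ord -cardsT.
  apply: (leq_card_representatives (P := fun u i => inl i \in B u)) => [u|u v i].
    by rewrite inE => /existsP[i iu]; exists i; rewrite ?inE.
  exact: (model_disjoint mB).
have [u0 u0U] : exists u0, u0 \notin U.
  apply/existsP; rewrite -negb_forall; apply/negP => /forallP allU.
  have : #|H| <= #|U| by rewrite -cardsT; apply: subset_leq_card; apply/subsetP=> u _.
  lia.
have inrB u x : u \notin U -> x \in B u -> exists p, x = inr p.
  case: x => [i|p] uU xu; last by exists p.
  by case/negP: uU; rewrite inE; apply/existsP; exists i.
have [x0 x0u] := set0Pn _ (model_neq0 mB u0).
have [p0 x0E] := inrB _ _ u0U x0u; rewrite {x0}x0E in x0u.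
have sameB u p q : u \notin U -> inr p \in B u -> inr q \in B u -> q.1 = p.1.
  move=> uU pu qu.
  have := connect_invariant (P := fun x : clique_join =>
    forall q, x = inr q -> q.1 = p.1) _ (model_connected mB u _ _ pu qu).
  apply=> //; last by move=> r [->].
  move=> y z IH /and3P[yu zu yz] r zr; have [p' yE] := inrB _ _ uU yu.
  by move: yz; rewrite yE zr => /andP[/eqP<- _]; apply: IH.
have block u : u \notin U -> forall q, inr q \in B u -> q.1 = p0.1.
  move=> uU q qu; apply: (connect_invariant (P := fun u => forall q,
    inr q \in B u -> q.1 = p0.1)) (vertex_cutPn (cutH _ U_s) u0U uU) _ _ qu.
    move=> v w IH /and3P[vU wU /(model_adj mB)[x [y [xv yw +]]]] {}q {}qw.
    have [p xE] := inrB _ _ vU xv; have [r yE] := inrB _ _ wU yw.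
    rewrite xE yE => /andP[/eqP pr _]; rewrite xE in xv; rewrite yE in yw.
    by rewrite (sameB _ _ _ wU yw qw) -pr; apply: IH.
  by move=> {}q {}qu; apply: sameB u0U _ _.
have : #|~: U| <= b.
  rewrite -[leqRHS]card_ord -cardsT.
  apply: (leq_card_representatives (P := fun u j => inr (p0.1, j) \in B u)) => [u|u v i].
    rewrite inE => uU; have [x xu] := set0Pn _ (model_neq0 mB u).
    have [[i j] xE] := inrB _ _ uU xu; exists j; rewrite ?inE //.
    by rewrite xE in xu; rewrite -(block _ uU _ xu).
  exact: (model_disjoint mB).
by have := cardsC U; lia.
Qed.

End JoinOfCliques.

(** The closed neighbourhoods of two vertices share at least 2(d+1) - |H|
    vertices, so one of the common vertices avoids U. *)
Lemma degree_no_cut (H : sgraph) (d : nat) (U : {set H}) :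
  (forall v : H, d <= #|nbrs v|) -> #|U| + #|H| < d.+1.*2 -> ~~ vertex_cut U.
Proof.
move=> degH ltU; apply/existsP => -[x /existsP[y /and3P[xU yU]]]; case/negP.
have [z] : exists z, z \in (x |: nbrs x) :&: (y |: nbrs y) :\: U.
  apply/set0Pn; rewrite -card_gt0.
  have := cardsID U ((x |: nbrs x) :&: (y |: nbrs y)).
  have := subset_leq_card (subsetIr ((x |: nbrs x) :&: (y |: nbrs y)) U).
  have := cardsUI (x |: nbrs x) (y |: nbrs y).
  have := subset_leq_card (subsetT ((x |: nbrs x) :|: (y |: nbrs y))).
  rewrite cardsT !cardsU1 !inE !adj_irrefl /=; have := degH x; have := degH y.
  by move: ltU; set h := #|H|; set u := #|U|; lia.
rewrite !inE => /andP[zU /andP[xz yz]].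
have link u : (z == u) || adj u z -> u \notin U ->
    connect [rel u v | [&& u \notin U, v \notin U & adj u v]] u z.
  by case/orP=> [/eqP-> //|uz uU]; apply: connect1; rewrite /= uU zU.
apply: connect_trans (link x xz xU) _.
case/orP: yz => [/eqP<- //|yz].
by apply: connect1; rewrite /= yU zU adj_sym.
Qed.

(** * A clique with pendant vertices *)

Lemma nth_enum_in (T : finType) (A B : {set T}) (x0 : T) n :
  A \subset B -> n < #|B| ->
  (nth x0 (enum A ++ enum (B :\: A)) n \in B) /\
  (n < #|A| -> nth x0 (enum A ++ enum (B :\: A)) n \in A).
Proof.
move=> sAB ltn; have memAB z : z \in enum A ++ enum (B :\: A) -> z \in B.
  by rewrite mem_cat !mem_enum !inE => /orP[/(subsetP sAB)|/andP[]].
split.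
  apply: memAB; apply: mem_nth; rewrite size_cat -!cardE cardsD.
  by rewrite (setIidPr sAB) subnKC // subset_leq_card.
by move=> ltA; rewrite nth_cat -cardE ltA -mem_enum mem_nth // -cardE.
Qed.

Lemma uniq_enum_cat (T : finType) (A B : {set T}) :
  uniq (enum A ++ enum (B :\: A)).
Proof.
rewrite cat_uniq !enum_uniq andbT /=; apply/hasPn=> z.
by rewrite !mem_enum !inE => /andP[].
Qed.

(** Both sides are listed with the prescribed subset first, and elements are
    matched by their rank. *)
Lemma injection_extend (S T : finType) (A B : {set S}) (P Q : {set T}) (t0 : T) :
  A \subset B -> P \subset Q -> #|A| <= #|P| -> #|B| <= #|Q| ->
  exists g : S -> T, [/\ {in B &, injective g}, {in B, forall v, g v \in Q}
    & {in A, forall v, g v \in P}].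
Proof.
move=> sAB sPQ leAP leBQ.
pose lB := enum A ++ enum (B :\: A).
have memB v : (v \in lB) = (v \in B).
  rewrite mem_cat !mem_enum inE; case: (boolP (v \in A)) => //.
  by move/(subsetP sAB)->.
have sizeB : size lB = #|B|.
  rewrite size_cat -!cardE cardsD (setIidPr sAB) subnKC //.
  exact: subset_leq_card.
have idx v : v \in B -> index v lB < #|Q|.
  by move=> vB; apply: leq_trans leBQ; rewrite -sizeB index_mem memB.
exists (fun v => nth t0 (enum P ++ enum (Q :\: P)) (index v lB)); split.
- move=> u v uB vB /eqP; rewrite nth_uniq ?uniq_enum_cat //.
  + by move/eqP/index_inj => -> //; rewrite memB.
  + rewrite size_cat -!cardE cardsD (setIidPr sPQ) subnKC ?idx //.
    exact: subset_leq_card.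
  + rewrite size_cat -!cardE cardsD (setIidPr sPQ) subnKC ?idx //.
    exact: subset_leq_card.
- by move=> v vB; have [] := nth_enum_in t0 sPQ (idx v vB).
- move=> v vA; have vB := subsetP sAB _ vA.
  have [_] := nth_enum_in t0 sPQ (idx v vB); apply.
  apply: leq_trans leAP; rewrite /lB index_cat mem_enum vA cardE index_mem.
  by rewrite mem_enum.
Qed.

(** D serves as the branch set of v0. The other vertices of H go to distinct
    vertices of the clique Q, the neighbours of v0 to vertices adjacent to D. *)
Lemma clique_attach_minor (G H : sgraph) (Q D P : {set G}) (v0 : H) :
  clique Q -> #|H| <= #|Q|.+1 -> connected_in D -> D != set0 ->
  (forall x, x \in D -> x \notin Q) -> P \subset Q -> #|nbrs v0| <= #|P| ->
  (forall x, x \in P -> exists2 y, y \in D & adj y x) ->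
  has_minor G H.
Proof.
move=> cQ leH cD D0 DQ sPQ leP adjP; apply/has_minorP.
have [d0 d0D] := set0Pn _ D0.
have [||g [gI gQ gP]] := injection_extend d0 (A := nbrs v0) (B := [set~ v0]) _ sPQ leP.
- by apply/subsetP=> v; rewrite !inE => /adj_neq; rewrite eq_sym.
- by have := cardsC1 v0; lia.
have inC v : v != v0 -> v \in [set~ v0] by rewrite !inE.
exists (fun v => if v == v0 then D else [set g v]); split.
- move=> v; case: (eqVneq v v0) => // _; apply/set0Pn; exists (g v); exact: set11.
- by move=> v; case: eqP => // _; apply: connected_in1.
- move=> u v x; have [->|nu] := eqVneq u v0; have [->|nv] := eqVneq v v0 => //.
  + by move=> /DQ + /set1P xE; rewrite xE gQ ?inC.
  + by move=> /set1P xE /DQ; rewrite xE gQ ?inC.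
  + by move=> /set1P-> /set1P/gI; apply; apply: inC.
- move=> u v uv; have [uE|nu] := eqVneq u v0; have [vE|nv] := eqVneq v v0.
  + by have := adj_neq uv; rewrite uE vE eqxx.
  + have vP : g v \in P by apply: gP; rewrite inE -uE.
    by have [y yD yg] := adjP _ vP; exists y, (g v); rewrite set11.
  + have uP : g u \in P by apply: gP; rewrite inE -vE adj_sym.
    by have [y yD yg] := adjP _ uP; exists (g u), y; rewrite set11 adj_sym.
  + exists (g u), (g v); rewrite !set11; split=> //.
    apply: cQ; rewrite ?gQ ?inC //; apply: contraTneq (adj_neq uv) => /gI.
    by move=> ->; rewrite ?inC // eqxx.
Qed.

(** The complete graph on a vertices together with one extra vertex for each
    set of k of them, adjacent exactly to this set. *)
Section PendantCliques.
Variables a k : nat.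

Definition pendant := {X : {set 'I_a} | #|X| == k}.

Definition pendant_rel : rel ('I_a + pendant) := fun x y =>
  match x, y with
  | inl i, inl j => i != j
  | inl i, inr X => i \in val X
  | inr X, inl i => i \in val X
  | inr _, inr _ => false
  end.

Lemma pendant_sym : symmetric pendant_rel.
Proof. by case=> x [] y //=; rewrite eq_sym. Qed.

Lemma pendant_irrefl : irreflexive pendant_rel.
Proof. by case=> x /=; rewrite ?eqxx. Qed.

Definition pendant_graph : sgraph := SGraph pendant_sym pendant_irrefl.

Definition pendants : {set pendant_graph} := [set x | if x is inr _ then true else false].

Lemma card_pendants : #|pendants| = 'C(a, k).
Proof.
have <- : #|{: pendant}| = 'C(a, k).
  rewrite card_sig -[a in RHS]card_ord -card_draws.
  by apply: eq_card => X; rewrite !inE.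
have -> : pendants = [set (inr S : pendant_graph) | S in {: pendant}].
  apply/setP=> -[i|S]; rewrite inE /=; last by rewrite imset_f.
  by apply/esym/imsetP=> -[].
by rewrite card_imset // => S T [].
Qed.

Lemma degree_pendant (x : pendant_graph) : x \in pendants -> #|nbrs x| = k.
Proof.
rewrite inE; case: x => // S _; transitivity #|val S|; last exact: eqP (valP S).
have inlI : injective (inl : 'I_a -> pendant_graph) by move=> i j [].
rewrite -(card_imset _ inlI); apply: eq_card => -[i|T]; rewrite !inE /=.
  by rewrite (mem_imset _ _ inlI).
by apply/esym/imsetP=> -[].
Qed.

(** A branch set that misses the complete graph is a single pendant vertex,
    whose degree k is too small. So every branch set contains one of the a
    vertices of the complete graph, and there are more branch sets than that. *)
Lemma pendant_graph_free (H : sgraph) :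
  (forall v : H, k < #|nbrs v|) -> a < #|H| -> minor_free H pendant_graph.
Proof.
move=> degH ltH /has_minorP[B mB].
have core u : exists i, inl i \in B u.
  apply: contrapT => no_core.
  have inrB x : x \in B u -> exists S, x = inr S.
    by case: x => [i iu|S _]; [case: no_core; exists i | exists S].
  have [x0 x0u] := set0Pn _ (model_neq0 mB u).
  have [S x0E] := inrB _ x0u; rewrite {x0}x0E in x0u.
  have uniqB x : x \in B u -> x = inr S.
    move=> xu; apply: (connect_invariant (P := fun x => x = inr S))
      (model_connected mB u _ _ x0u xu) _ => // y z -> /and3P[_ zu].
    by have [T ->] := inrB _ zu.
  pose X : {set 'I_a} := val S; have cardX : #|X| = k := eqP (valP S).
  suff : #|nbrs u| <= #|X| by rewrite cardX leqNgt degH.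
  apply: (leq_card_representatives (P := fun v i => inl i \in B v)); last first.
    by move=> v w i; apply: (model_disjoint mB).
  move=> v; rewrite inE => /(model_adj mB)[x [y [/uniqB-> yv]]].
  by case: y yv => // i iv iS; exists i.
have : #|[set: H]| <= #|[set: 'I_a]|.
  apply: (leq_card_representatives (P := fun v i => inl i \in B v)); last first.
    by move=> v w i; apply: (model_disjoint mB).
  by move=> v _; have [i iv] := core v; exists i.
by rewrite !cardsT card_ord leqNgt ltH.
Qed.

Lemma add_edge_minor_sym (G H : sgraph) (x y : G) :
  has_minor (add_edge x y) H -> has_minor (add_edge y x) H.
Proof.
apply: has_minor_trans; apply: subgraph_minor; exists id => // u v.
by rewrite /= /add_edge_rel orbC [y == x]eq_sym [_ || (u == y) && _]orbC orbC.
Qed.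

(** A new edge at a pendant vertex raises the number of neighbours in the
    complete graph to the minimum degree of H, either directly or after
    merging two pendant vertices with different neighbourhoods; then
    [clique_attach_minor] applies. *)
Lemma pendant_graph_maximal (H : sgraph) (v0 : H) :
  (forall v : H, k < #|nbrs v|) -> #|nbrs v0| = k.+1 -> #|H| = a.+1 ->
  edge_maximal_free H pendant_graph.
Proof.
move=> degH deg0 cardH; split; first by apply: pendant_graph_free; rewrite ?cardH.
have inlI : injective (inl : 'I_a -> pendant_graph) by move=> i j [].
have main (S : pendant) (y : pendant_graph) (i : 'I_a) : i \notin val S ->
    (if y is inr T then i \in val T else y == inl i) ->
    has_minor (@add_edge pendant_graph (inr S) y) H.
  move=> iS yi.
  pose D : {set pendant_graph} := inr S |: (if y is inr T then [set inr T] else set0).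
  apply: (@clique_attach_minor (@add_edge pendant_graph (inr S) y) H
    [set inl i | i in 'I_a] D [set inl j | j in i |: val S] v0).
  - by move=> _ _ /imsetP[j _ ->] /imsetP[l _ ->]; rewrite /= /add_edge_rel /= => ->.
  - by rewrite card_imset // cardH card_ord.
  - case: y yi @D => [l|T] yi D; first by rewrite /D setU0; apply: connected_in1.
    move=> p q /set2P[]-> /set2P[]-> //; apply: connect1;
      by rewrite /set_adj /= !inE !eqxx ?orbT /= /add_edge_rel /= !eqxx ?orbT ?andbT //;
         apply/eqP => -[ST]; rewrite ST yi in iS.
  - by apply/set0Pn; exists (inr S); rewrite !inE eqxx.
  - move=> p pD; apply/imsetP=> -[l _ pE]; move: pD; rewrite pE /D !inE /=.
    by case: (y) => [?|?]; rewrite !inE.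
  - by apply/subsetP=> _ /imsetP[j _ ->]; apply: imset_f.
  - by rewrite card_imset // cardsU1 iS (eqP (valP S)) deg0.
  - move=> _ /imsetP[j /setU1P[->|jS] ->]; last first.
      by exists (inr S); rewrite ?inE ?eqxx //= /add_edge_rel /= jS.
    case: y yi @D => [l /eqP-> D|T iT D].
      by exists (inr S); rewrite ?inE ?eqxx //= /add_edge_rel /= !eqxx orbT.
    by exists (inr T); rewrite ?inE ?eqxx ?orbT //= /add_edge_rel /= iT.
move=> [i|S] [j|T] nxy nadj.
- by case/negP: nadj; rewrite /= (inj_eq inlI) in nxy *.
- by apply: add_edge_minor_sym; apply: main (i) _ _.
- by apply: main (j) _ _.
- have [i iT iS] : exists2 i, i \in val T & i \notin val S.
    apply/subsetPn; apply: contraNN nxy => sTS; apply/eqP; congr inr; apply: val_inj.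
    apply/eqP; rewrite eq_sym eqEcard sTS.
    by rewrite (eqP (valP S)) (eqP (valP T)) leqnn.
  by apply: main (i) _ _.
Qed.

End PendantCliques.

(** * The gap is unbounded: H not complete *)

(** Cheap vertices: deleting them from a graph costs at most k edges each. *)
Definition sparse_independent (G : sgraph) (k : nat) (W : {set G}) : Prop :=
  (forall x y, x \in W -> y \in W -> ~~ adj x y) /\
  (forall x, x \in W -> #|nbrs x| <= k).

Lemma clique_independent (G : sgraph) (k : nat) (Q W : {set G}) :
  clique Q -> sparse_independent k W -> #|W| <= #|W :\: Q|.+1.
Proof.
move=> cQ [indW _]; rewrite -(cardsID Q W) -addn1 addnC leq_add2l.
rewrite leqNgt; apply/card_gt1P => -[x [y [/setIP[xW xQ] /setIP[yW yQ] nxy]]].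
by have := indW x y xW yW; rewrite cQ.
Qed.

(** The edges created by extending the disjoint union join two cliques, and
    each of these contains at most one vertex of the independent set on its
    side. *)
Lemma union_sparse_independent (H G1 G2 : sgraph) k (W1 : {set G1}) (W2 : {set G2}) :
  two_connected H -> edge_maximal_free H G1 -> edge_maximal_free H G2 ->
  sparse_independent k W1 -> sparse_independent k W2 ->
  exists (G : sgraph) (W : {set G}),
    [/\ edge_maximal_free H G, sparse_independent k W
      & #|W1| + #|W2| <= #|W|.+2].
Proof.
move=> H2 max1 max2 sp1 sp2.
have [r [rs [ri [Q1 [Q2 [maxr [c1 c2] r1 r2 r12]]]]]] :=
  edge_maximal_union (two_connected_card_gt0 H2) (two_connected_connected H2)
    max1 max2 (edge_maximal_connected H2 max1) (edge_maximal_connected H2 max2).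
have noL a b : a \notin Q1 -> r (inl a) (inr b) = false.
  by move=> aQ; apply/negP => /r12; rewrite (negPf aQ).
have noR a b : b \notin Q2 -> r (inl a) (inr b) = false.
  by move=> bQ; apply/negP => /r12; rewrite (negPf bQ) andbF.
pose W : {set G1 + G2} := [set x | match x with
  | inl a => a \in W1 :\: Q1 | inr b => b \in W2 :\: Q2 end].
have inlI : injective (inl : G1 -> G1 + G2) by move=> a b [].
have inrI : injective (inr : G2 -> G1 + G2) by move=> a b [].
have indL := proj1 sp1; have indR := proj1 sp2.
exists (SGraph rs ri), W; split=> //.
- split=> [[a|a] [b|b]|[a|b]]; rewrite !inE.
  + by move=> /andP[_ aW] /andP[_ bW] /=; rewrite r1 indL.
  + by move=> /andP[aQ _] _; rewrite /= noL.
  + by move=> _ /andP[bQ _]; rewrite /= rs noL.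
  + by move=> /andP[_ aW] /andP[_ bW] /=; rewrite r2 indR.
  + case/andP=> aQ aW; apply: leq_trans (proj2 sp1 _ aW).
    rewrite -(card_imset _ inlI); apply: subset_leq_card; apply/subsetP=> -[c|c].
      by rewrite !inE /= r1 => ac; apply: imset_f; rewrite inE.
    by rewrite inE /= noL.
  + case/andP=> bQ bW; apply: leq_trans (proj2 sp2 _ bW).
    rewrite -(card_imset _ inrI); apply: subset_leq_card; apply/subsetP=> -[c|c].
      by rewrite inE /= rs noR.
    by rewrite !inE /= r2 => ac; apply: imset_f; rewrite inE.
- apply: leq_trans (leq_add (clique_independent c1 sp1)
    (clique_independent c2 sp2)) _.
  rewrite addSn addnS !ltnS eq_leq //.
  rewrite -(card_imset _ inlI) -(card_imset _ inrI) -cardsUI.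
  rewrite -[RHS]addn0; congr (_ + _).
    apply: eq_card => -[c|c]; rewrite !inE /=.
      rewrite (mem_imset _ _ inlI) orbC; case: imsetP => [[]|_] //.
      by rewrite !inE.
    rewrite (mem_imset _ _ inrI); case: imsetP => [[]|_] //.
    by rewrite !inE.
  apply: eq_card0 => x; apply/negP => /setIP[/imsetP[a _ ->] /imsetP[b _]].
  by [].
Qed.

Lemma many_sparse_independent (H : sgraph) k t (A : sgraph) (W : {set A}) :
  two_connected H -> edge_maximal_free H A -> sparse_independent k W ->
  2 < #|W| ->
  exists (G : sgraph) (W : {set G}),
    [/\ edge_maximal_free H G, sparse_independent k W & t <= #|W|].
Proof.
move=> H2 maxA spW W3; elim: t => [|t [G [W' [maxG spG tW]]]].
  by exists A, W.
have [G' [W'' [maxG' spG' leW]]] := union_sparse_independent H2 maxG maxA spG spW.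
by exists G', W''; split=> //; lia.
Qed.

Lemma num_edges_delete (G : sgraph) k (W : {set G}) :
  sparse_independent k W ->
  num_edges G <= num_edges (induced (~: W)) + #|W| * k.
Proof.
move=> [_ degW]; rewrite -leq_double doubleD -!darts_double darts_induced.
have le1 : \sum_(x in W) \sum_y adj x y <= #|W| * k.
  rewrite -sum_nat_const; apply: leq_sum => x xW.
  have := sum_adj setT x; rewrite setIT => E.
  apply: leq_trans (degW x xW); rewrite -E eq_leq //.
  by apply: eq_bigl => y; rewrite inE.
rewrite /darts (bigID (mem W)) /= -addnn addnCA leq_add //.
rewrite (eq_bigr (fun x => \sum_(y in W) adj x y +
   \sum_(y in ~: W) adj x y)) => [|x _]; last first.
  rewrite (bigID (mem W)) /=; congr (_ + _).
  by apply: eq_bigl => y; rewrite inE.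
rewrite big_split /= addnC leq_add //.
  by rewrite eq_leq //; apply: eq_bigl => x; rewrite inE.
apply: leq_trans le1; rewrite exchange_big /=; apply: leq_sum => x _.
rewrite big_mkcond /=; apply: leq_sum => y _.
by rewrite adj_sym; case: ifP.
Qed.

(** Compare G with the union of a densest graph on as many vertices as G - W
    and a densest graph on |W| vertices: the former has at least as many edges
    as G - W, so the two differ by at least what the latter has beyond the
    k|W| edges at W. *)
Lemma gap_sparse_independent (H G : sgraph) k (W : {set G}) :
  two_connected H -> edge_maximal_free H G -> sparse_independent k W ->
  max_edges H #|W| <= gap H #|G| + #|W| * k.
Proof.
move=> H2 maxG spW.
have := min_edges_maximal maxG; have := num_edges_delete spW.
have freeW : minor_free H (induced (~: W)).
  by apply: minor_free_sub (proj1 maxG); apply: subgraph_minor; apply: induced_subgraph.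
have := max_edges_free freeW; rewrite card_induced.
have := max_edges_add H2 #|W| #|~: W|; rewrite cardsC /gap.
lia.
Qed.

Lemma sparse_independent_sub (G : sgraph) k (W : {set G}) n :
  sparse_independent k W -> n <= #|W| ->
  exists2 W' : {set G}, sparse_independent k W' & #|W'| = n.
Proof.
move=> [ind deg] leW; exists [set x in take n (enum W)].
  have sub x : x \in [set x in take n (enum W)] -> x \in W.
    by rewrite inE => /mem_take; rewrite mem_enum.
  by split=> [x y /sub xW /sub yW|x /sub]; [apply: ind | apply: deg].
rewrite cardsE; have /card_uniqP -> : uniq (take n (enum W)).
  by rewrite take_uniq ?enum_uniq.
by rewrite size_take -cardE; case: ltngtP leW.
Qed.

Lemma leq_bin n k : 0 < k < n -> n <= 'C(n, k).
Proof.
elim: n k => // n IHn [|k] //=; rewrite ltnS leq_eqVlt => /predU1P[->|ltkn].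
  by rewrite binSn.
have := IHn k.+1; rewrite ltkn => /(_ isT); rewrite binS.
have : 0 < 'C(n, k) by rewrite bin_gt0 ltnW ?(ltnW ltkn).
lia.
Qed.

(** Sparse graphs come from repeated unions of the pendant graph, dense ones
    from cliques K_b joined to a common clique K_s. The average degree of the
    latter tends to 2s + b - 1, which exceeds 2(d - 1) by the choice of s. *)
Lemma gap_unbounded_noncomplete (H : sgraph) (C : nat) :
  two_connected H -> ~~ is_complete H -> exists n, C < gap H n.
Proof.
move=> H2 /forallPn[x /forallPn[y]]; rewrite negb_imply => /andP[nxy nadj].
(* A vertex of minimum degree; |H| >= d + 2 because x has a non-neighbour
   y. *)
pose v0 := [arg min_(v < x) #|nbrs v|].
have degH (v : H) : #|nbrs v0| <= #|nbrs v|.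
  by rewrite /v0; case: arg_minnP => // i _; apply.
set d := #|nbrs v0| in degH.
have d2 : 1 < d := two_connected_degree H2 v0.
have dh : d.+2 <= #|H|.
  apply: (@leq_trans (#|nbrs x|.+2)); first by rewrite !ltnS.
  have : #|x |: (y |: nbrs x)| <= #|H| by rewrite -cardsT subset_leq_card ?subsetT.
  by rewrite !cardsU1 !inE adj_irrefl (negPf nxy) (negPf nadj).
set h := #|H| in dh.
have [k kE] : exists k, d = k.+1 by exists d.-1; lia.
have [a aE] : exists a, h = a.+1 by exists h.-1; lia.
have maxA : edge_maximal_free H (pendant_graph a k).
  by apply: (@pendant_graph_maximal a k H v0) => // v; rewrite -kE.
have spA : sparse_independent k (pendants a k).
  split; last by move=> p /degree_pendant->.
  by move=> [i|p] [j|q]; rewrite !inE.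
have W3 : 2 < #|pendants a k|.
  rewrite card_pendants.
  by apply: leq_trans (leq_bin _); lia.
(* By 2-connectedness when s = 1, and by the minimum degree otherwise,
   removing at most s vertices does not disconnect H. Together with s + b =
   h - 1 this makes clique_join s t b H-free; and 2s + b - 1 >= 2(d - 1) +
   1. *)
pose s := maxn 1 (d.*2.+1 - h).
have cutH (U : {set H}) : #|U| <= s -> ~~ vertex_cut U.
  rewrite /s /maxn; case: ifP => [lt Us|_]; last exact: two_connected_cut.
  by apply: (degree_no_cut degH); rewrite -/h; lia.
pose b := h.-1 - s.
(* The join has at least k + 1/2 edges per vertex in the copies of K_b,
   while the vertices of K_s may cost s * k. *)
pose t := 2 * C + 2 * (s * k) + 2.
have [G [W [maxG spW leW]]] := many_sparse_independent (s + t * b) H2 maxA spA W3.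
have [W' spW' cardW'] := sparse_independent_sub spW leW.
exists #|G|; have := gap_sparse_independent H2 maxG spW'.
have freeJ : minor_free H (clique_join s t b).
  by apply: clique_join_free => //; rewrite -/h /b; lia.
have := max_edges_free freeJ; rewrite card_clique_join cardW'.
have := num_edges_clique_join s t b.
set M := max_edges _ _; set e := num_edges _.
have b1 : 0 < b by rewrite /b /s; lia.
have dens : k.*2.+1 <= s.*2 + b.-1 by rewrite /b /s; lia.
have : t * b * k.*2.+1 <= t * b * (s.*2 + b.-1) by rewrite leq_mul2l dens orbT.
have : t <= t * b by rewrite leq_pmulr.
rewrite {1}/t mulnDl -addn1 -muln2.
move: (t * b) => tb; nia.
Qed.

(** * The gap is unbounded: H complete *)

Lemma model_precomp (G K H : sgraph) (f : K -> H) (B : H -> {set G}) :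
  injective f -> (forall x y, adj x y -> adj (f x) (f y)) ->
  minor_model B -> minor_model (fun u => B (f u)).
Proof.
move=> injf homf mB; split.
- by move=> u; apply: (model_neq0 mB).
- by move=> u; apply: (model_connected mB).
- by move=> u v x xu xv; apply: injf; apply: (model_disjoint mB xu xv).
- by move=> u v /homf; apply: (model_adj mB).
Qed.

(** If the new vertex of G lies in the branch set of a vertex v of H, that
    branch set is exchanged for the one of the new vertex of H, which is
    adjacent to all the others; then no branch set in use contains the new
    vertex of G. *)
Lemma cone_modelK (G H : sgraph) : has_model (cone G) (cone H) -> has_model G H.
Proof.
case=> B mB.
pose f (v : H) : cone H := if None \in B (Some v) then None else Some v.
have noneB u v : None \in B u -> None \in B v -> u = v by apply: (model_disjoint mB).
have injf : injective f.
  move=> u v; rewrite /f; case: ifP => [uN|_]; case: ifP => [vN|_] //; last by case.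
  by have [] := noneB _ _ uN vN.
have homf (u v : H) : adj u v -> @adj (cone H) (f u) (f v).
  rewrite /f => uv; case: ifP => [uN|_]; case: ifP => [vN|_] //.
  by have [uvE] := noneB _ _ uN vN; rewrite uvE adj_irrefl in uv.
apply: (@model_pullback G (cone G) H Some) (model_precomp injf homf mB) _ => //.
  by move=> a b [].
move=> u [x|]; first by exists x.
rewrite /f; case: ifPn => [uN uN'|/negP //].
by have := noneB _ _ uN uN'.
Qed.

Lemma cone_edge_maximal (G H : sgraph) :
  edge_maximal_free H G -> edge_maximal_free (cone H) (cone G).
Proof.
move=> [freeG maxG]; split.
  by move=> /has_minorP/cone_modelK/has_minorP.
move=> [x|] [y|] // nxy nadj.
apply: (@has_minor_trans _ (cone (add_edge x y))).
  by apply: subgraph_minor; exists id => // -[u|] [v|].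
apply: model_has_minor; apply: cone_model; apply: has_minor_model.
exact: maxG.
Qed.

Lemma big_option (T : finType) (F : option T -> nat) :
  \sum_x F x = F None + \sum_x F (Some x).
Proof.
rewrite (bigD1 None) //=; congr (_ + _).
rewrite (reindex_omap (@Some T) id) => [|[]//].
by apply: eq_bigl => x; rewrite /= eqxx.
Qed.

Lemma num_edges_cone (G : sgraph) : num_edges (cone G) = num_edges G + #|G|.
Proof.
apply: double_inj; rewrite doubleD -!darts_double /darts big_option /=.
have sum1 : \sum_(x : G) true = #|G| by rewrite sum_nat_const muln1.
rewrite big_option /= sum1; under [X in _ + X]eq_bigr do rewrite big_option /=.
by rewrite big_split /= sum1 add0n addnA addnn addnC.
Qed.

(** Coning preserves edge-maximality and adds exactly n edges to any graph on
    n vertices. *)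
Lemma gap_cone (H : sgraph) n :
  two_connected H -> gap H n <= gap (cone H) n.+1.
Proof.
move=> H2; have [G1 [G1n max1 e1]] := max_edges_attained H2 n.
have [G2 [G2n max2 e2]] := min_edges_attained H2 n.
have := max_edges_maximal (cone_edge_maximal max1).
have := min_edges_maximal (cone_edge_maximal max2).
rewrite !num_edges_cone !card_option G1n G2n e1 e2 /gap.
lia.
Qed.

Lemma gap_isomorphic (H K : sgraph) n : isomorphic H K -> gap H n = gap K n.
Proof.
move=> HK.
have minorE G : has_minor G H = has_minor G K.
  apply: propext; split=> /has_minor_trans; apply; apply: subgraph_minor;
    apply: isomorphic_subgraph => //; exact: isomorphic_sym.
have maxE G : edge_maximal_free H G = edge_maximal_free K G.
  rewrite /edge_maximal_free /minor_free minorE; congr (_ /\ _).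
  by apply: eq_forall => x; apply: eq_forall => y; rewrite minorE.
have countE : edge_counts H n = edge_counts K n.
  by apply: funext => m; rewrite /edge_counts; apply: eq_exists => G; rewrite maxE.
by rewrite /gap /max_edges /min_edges countE.
Qed.

Lemma complete_is_complete n : is_complete (complete_graph n).
Proof. by apply/forallP => x; apply/forallP => y; apply/implyP. Qed.

Lemma complete_two_connected n : two_connected (complete_graph n.+3).
Proof. by rewrite /two_connected /connectivity complete_is_complete card_ord. Qed.

Lemma is_complete_isomorphic (H : sgraph) :
  is_complete H -> isomorphic H (complete_graph #|H|).
Proof.
move=> /forallP cH; exists enum_rank; first exact: enum_rank_bij.
move=> x y; rewrite /= (inj_eq enum_rank_inj).
apply/idP/idP => [xy|/adj_neq //].
by move/forallP/(_ y)/implyP: (cH x); apply.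
Qed.

(** The Wagner graph is the 8-cycle with its four long diagonals. It is given
    on natural numbers so that finite checks reduce to computations on lists. *)
Definition wagner_nat (i j : nat) : bool :=
  j \in [:: (i + 1) %% 8; (i + 7) %% 8; (i + 4) %% 8].

Lemma all_iota2P n (P : nat -> nat -> bool) :
  all (fun i => all (P i) (iota 0 n)) (iota 0 n) ->
  forall i j : 'I_n, P i j.
Proof.
move=> /allP Pall i j.
have iP (k : 'I_n) : (k : nat) \in iota 0 n by rewrite mem_iota ltn_ord.
exact: (allP (Pall _ (iP i)) _ (iP j)).
Qed.

Lemma wagner_sym : symmetric (fun i j : 'I_8 => wagner_nat i j).
Proof.
move=> i j; apply/eqP.
by apply: (@all_iota2P 8 (fun i j => wagner_nat i j == wagner_nat j i)).
Qed.

Lemma wagner_irrefl : irreflexive (fun i j : 'I_8 => wagner_nat i j).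
Proof.
move=> i; apply/negbTE.
have := @all_iota2P 8 (fun i j => (i == j) ==> ~~ wagner_nat i j) isT i i.
by rewrite eqxx.
Qed.

Definition wagner : sgraph := SGraph wagner_sym wagner_irrefl.

Lemma wagner_degree (x : wagner) : #|nbrs x| <= 3.
Proof.
pose s := [seq (inord i : 'I_8) | i <- [:: (x + 1) %% 8; (x + 7) %% 8; (x + 4) %% 8]].
apply: (@leq_trans #|s|); last exact: card_size.
apply: subset_leq_card; apply/subsetP=> y; rewrite inE => xy.
by rewrite -(inord_val y) map_f.
Qed.

Lemma wagner_num_edges : num_edges wagner <= 12.
Proof.
rewrite -leq_double -darts_double.
apply: (@leq_trans (\sum_(x : 'I_8) 3)); last by rewrite sum_nat_const card_ord.
apply: leq_sum => x _; apply: leq_trans (wagner_degree x).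
by rewrite -[nbrs x]setIT -sum_adj eq_leq //; apply: eq_bigl => y; rewrite inE.
Qed.

Lemma wagner_clique (Q : {set wagner}) : clique Q -> #|Q| <= 2.
Proof.
move=> cQ; rewrite leqNgt; apply/negP => /card_gt2P[x [y [z [[xQ yQ zQ] [nxy nyz nzx]]]]].
have xy := cQ _ _ xQ yQ nxy; have yz := cQ _ _ yQ zQ nyz; have zx := cQ _ _ zQ xQ nzx.
have := @all_iota2P 8 (fun i j => all (fun k =>
  ~~ [&& wagner_nat i j, wagner_nat j k & wagner_nat k i]) (iota 0 8)) isT x y.
by move=> /allP/(_ z); rewrite mem_iota /= ltn_ord => /(_ isT)/negP; apply; apply/and3P.
Qed.

(** A branch set with a single vertex has at most 3 neighbours, so each of the
    5 branch sets would have at least 2 of the 8 vertices. *)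
Lemma wagner_free : minor_free (complete_graph 5) wagner.
Proof.
move=> /has_minorP[B mB].
have twoB u : exists p : wagner * wagner, [/\ p.1 != p.2, p.1 \in B u & p.2 \in B u].
  have [x xu] := set0Pn _ (model_neq0 mB u).
  apply: contrapT => single.
  have uniqB y : y \in B u -> y = x.
    by move=> yu; apply/eqP; apply: contraT => nyx; case: single; exists (y, x).
  suff : #|[set~ u]| <= #|nbrs x|.
    by rewrite cardsC1 card_ord leqNgt ltnS wagner_degree.
  apply: (leq_card_representatives (P := fun v y => y \in B v)) => [v|v w y].
    rewrite !inE eq_sym => uv; have [a [b [/uniqB-> bv ab]]] := @model_adj _ _ _ mB u v uv.
    by exists b; rewrite ?inE.
  exact: (model_disjoint mB).
have [f fP] := choice twoB.
pose g (q : 'I_5 * bool) : wagner := if q.2 then (f q.1).1 else (f q.1).2.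
have gB q : g q \in B q.1 by rewrite /g; have [] := fP q.1; case: q.2.
have /leq_card : injective g.
  move=> [u b] [v c] E; have uv : u = v.
    by apply: (model_disjoint mB (gB (u, b))); rewrite E; apply: (gB (v, c)).
  subst v; congr pair; move: E; rewrite /g /=; have [/eqP nf _ _] := fP u.
  by case: b c => [] [] //= E; case: nf.
by rewrite card_prod card_bool !card_ord.
Qed.

(** The branch sets of a K_5 minor after adding the edge from 0 to d, for d =
    2 and d = 3: position i holds the label of the branch set of vertex i. Up
    to rotation and reversal these are all the pairs of non-adjacent vertices. *)
Definition wagner_labels (d : nat) : seq nat :=
  if d == 2 then [:: 0; 2; 1; 3; 3; 2; 4; 4] else [:: 0; 2; 2; 1; 3; 3; 4; 4].

Definition wagner_label (d x z : nat) : nat :=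
  nth 0 (wagner_labels d) ((z + 8 - x) %% 8).

Definition wagner_add (d x z z' : nat) : bool :=
  [|| wagner_nat z z', (z == x) && (z' == (x + d) %% 8)
    | (z == (x + d) %% 8) && (z' == x)].

Definition wagner_check (d x : nat) : bool :=
  all (fun z => all (fun z' => (wagner_label d x z == wagner_label d x z') ==>
     ((z == z') || wagner_nat z z')) (iota 0 8)) (iota 0 8) &&
  all (fun k => all (fun l => (k != l) ==>
    has (fun z => has (fun z' => [&& wagner_label d x z == k,
      wagner_label d x z' == l & wagner_add d x z z']) (iota 0 8)) (iota 0 8))
    (iota 0 5)) (iota 0 5).

Lemma wagner_checkP :
  all (fun x => wagner_check 2 x && wagner_check 3 x) (iota 0 8).
Proof. by vm_compute. Qed.

Lemma wagner_check_minor (x y : wagner) d :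
  wagner_check d x -> y = (x + d) %% 8 :> nat -> x != y ->
  has_minor (add_edge x y) (complete_graph 5).
Proof.
move=> /andP[/all_iota2P conn /all_iota2P adjc] yE neq_xy; apply: model_has_minor.
have addP (k l : 'I_5) : k != l -> exists z z' : wagner,
    [/\ wagner_label d x z = k, wagner_label d x z' = l & @adj (add_edge x y) z z'].
  move=> kl; have /hasP[z] := implyP (adjc k l) kl; rewrite mem_iota add0n => z8.
  case/hasP=> z'; rewrite mem_iota add0n => z'8 /and3P[/eqP zk /eqP z'l zz'].
  exists (Ordinal z8), (Ordinal z'8); split=> //.
  rewrite /= /add_edge_rel neq_xy /= -!val_eqE /= yE.
  case/or3P: zz' => [->//|/andP[/eqP<- /eqP<-]|/andP[/eqP zE /eqP z'E]].
  by rewrite !eqxx orbT.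
  by rewrite zE z'E !eqxx !orbT.
exists (fun k : 'I_5 => [set z : wagner | wagner_label d x z == k]); split.
- move=> k; have [l kl] : exists l : 'I_5, k != l.
    by case: (eqVneq k ord0) => [->|nk]; [exists ord_max | exists ord0].
  by have [z [_ [zk _ _]]] := addP _ _ kl; apply/set0Pn; exists z; rewrite inE zk.
- move=> k z z'; rewrite !inE => /eqP zk /eqP z'k.
  have := conn z z'; rewrite zk z'k eqxx /= => /orP[/eqP/val_inj->//|zz'].
  apply: connect1; rewrite /set_adj /= !inE zk z'k eqxx /=.
  by rewrite /add_edge_rel /= zz'.
- by move=> k l z; rewrite !inE => /eqP-> /eqP/val_inj.
- move=> k l kl; have [z [z' [zk z'l zz']]] := addP _ _ kl.
  by exists z, z'; rewrite !inE zk z'l.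
Qed.

Lemma wagner_maximal : edge_maximal_free (complete_graph 5) wagner.
Proof.
split; first exact: wagner_free.
move=> x y nxy nadj.
have chk (z : wagner) : wagner_check 2 z && wagner_check 3 z.
  by apply: (allP wagner_checkP); rewrite mem_iota /= ltn_ord.
have : [|| y == (x + 2) %% 8 :> nat, y == (x + 3) %% 8 :> nat,
    x == (y + 2) %% 8 :> nat | x == (y + 3) %% 8 :> nat].
  have := @all_iota2P 8 (fun i j => (i != j) ==> ~~ wagner_nat i j ==>
    [|| j == (i + 2) %% 8, j == (i + 3) %% 8, i == (j + 2) %% 8 |
      i == (j + 3) %% 8]) isT x y.
  by rewrite (inj_eq val_inj) nxy nadj.
case/or4P=> /eqP E.
- by have /andP[c2 _] := chk x; apply: wagner_check_minor c2 E _; rewrite // eq_sym.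
- by have /andP[_ c3] := chk x; apply: wagner_check_minor c3 E _; rewrite // eq_sym.
- have /andP[c2 _] := chk y; apply: add_edge_minor_sym.
  by apply: wagner_check_minor c2 E _; rewrite // eq_sym.
- have /andP[_ c3] := chk y; apply: add_edge_minor_sym.
  by apply: wagner_check_minor c3 E _; rewrite // eq_sym.
Qed.

(** A clique of the Wagner graph has at most 2 vertices and a clique of a
    graph without K_5 minor at most 4, so each union adds 8 vertices and at
    most 12 + 8 edges. *)
Lemma wagner_unions t : exists G : sgraph,
  [/\ #|G| = 8 * t.+1, edge_maximal_free (complete_graph 5) G
    & num_edges G <= 12 + 20 * t].
Proof.
have K5 := complete_two_connected 2.
elim: t => [|t [G [Gn maxG eG]]].
  by exists wagner; rewrite card_ord wagner_num_edges; split=> //; apply: wagner_maximal.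
have [r [rs [ri [Q1 [Q2 [maxr [c1 c2] r1 r2 r12]]]]]] :=
  edge_maximal_union (two_connected_card_gt0 K5) (two_connected_connected K5)
    maxG wagner_maximal (edge_maximal_connected K5 maxG)
    (edge_maximal_connected K5 wagner_maximal).
exists (SGraph rs ri); split=> //.
  by rewrite card_sum Gn card_ord; lia.
apply: leq_trans (num_edges_union_le rs ri r1 r2 r12) _.
have Q1_le : #|Q1| <= 4.
  by have := minor_free_clique (proj1 maxG) c1; rewrite card_ord ltnS.
have := leq_mul Q1_le (wagner_clique c2).
have := wagner_num_edges; lia.
Qed.

(** Three vertices joined to all others give about 3n edges, against 5n/2 for
    the unions of Wagner graphs. *)
Lemma gap_unbounded_K5 (C : nat) : exists n, C < gap (complete_graph 5) n.
Proof.
have [G [Gn maxG eG]] := wagner_unions C; exists #|G|.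
(* Chosen so that the join has as many vertices as G. *)
pose t := (8 * C + 5)%N.
have free : minor_free (complete_graph 5) (clique_join 3 t 1).
  apply: clique_join_free => [U _|]; last by rewrite card_ord.
  apply/existsP=> -[x /existsP[y /and3P[xU yU /negP[]]]].
  have [->//|nxy] := eqVneq x y.
  by apply: connect1; rewrite /= xU yU.
have := max_edges_free free; rewrite card_clique_join.
have -> : 3 + t * 1 = #|G| by rewrite Gn /t; lia.
have := num_edges_clique_join 3 t 1.
have := min_edges_maximal maxG; rewrite /gap /t; lia.
Qed.

Lemma gap_unbounded_complete k (C : nat) :
  exists n, C < gap (complete_graph (k + 5)) n.
Proof.
elim: k => [|k [n ltC]]; first exact: gap_unbounded_K5.
exists n.+1; rewrite -(gap_isomorphic _ (complete_cone (k + 5))).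
apply: leq_trans ltC (gap_cone _ _).
by rewrite addnC; apply: complete_two_connected.
Qed.

Lemma gap_unbounded (H : sgraph) (C : nat) :
  two_connected H -> ~ isomorphic H (complete_graph 3) ->
  ~ isomorphic H (complete_graph 4) -> exists n, C < gap H n.
Proof.
move=> H2 nK3 nK4; have [cH|ncH] := boolP (is_complete H); last first.
  exact: gap_unbounded_noncomplete.
have isoH := is_complete_isomorphic cH; have H3 := two_connected_card H2.
have h5 : 4 < #|H|.
  rewrite ltnNge; apply/negP => h4.
  have [hE|hE] : #|H| = 3 \/ #|H| = 4 by lia.
    by apply: nK3; rewrite -hE.
  by apply: nK4; rewrite -hE.
have [n ltn] := gap_unbounded_complete (#|H| - 5) C; rewrite subnK // in ltn.
by exists n; rewrite (gap_isomorphic _ isoH).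
Qed.

(** * Convergence *)

From mathcomp Require Import all_order all_algebra.
From mathcomp Require Import all_classical all_reals all_analysis.
From mathcomp Require Import ring lra.
Import Order.TTheory GRing.Theory Num.Theory.
Import numFieldNormedType.Exports.
Local Open Scope classical_set_scope.
Local Open Scope ring_scope.

Lemma superadditive_iter (f : nat -> nat) (c q N r : nat) :
  (forall a b, f a + f b <= f (a + b) + c)%N ->
  (q * f N <= f (q * N + r) + q * c)%N.
Proof.
move=> fD; elim: q => [|q IHq] //.
have := fD N (q * N + r)%N; rewrite addnA -mulSn; lia.
Qed.

(** Fekete's lemma for f - c, with the extra information that the limit, being
    the supremum of (f n - c)/n over positive n, is positive once f exceeds c. *)
Lemma superadditive_ratio (R : realType) (f : nat -> nat) (c K : nat) :
  (forall a b, f a + f b <= f (a + b) + c)%N -> (forall n, f n <= K * n)%N ->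
  (exists n, c < f n)%N ->
  exists2 l : R, 0 < l & (fun n => (f n)%:R / n%:R : R) @ \oo --> l.
Proof.
move=> fD fK [n0 ltn0].
have f0 : (f 0 = 0)%N by have := fK 0%N; lia.
pose u n : R := ((f n)%:R - c%:R) / n%:R.
pose E := [set u n.+1 | n in setT].
have leK n : u n.+1 <= K%:R.
  rewrite /u ler_pdivrMr ?ltr0n // -natrM lerBlDr.
  by rewrite -natrD ler_nat; have := fK n.+1; lia.
have supE : has_sup E.
  split; first by exists (u 1%N), 0%N.
  by exists K%:R => _ [n _ <-].
set l := sup E.
have ule n : (0 < n)%N -> u n <= l.
  by case: n => // n _; apply: sup_upper_bound => //; exists n.
have l0 : 0 < l.
  have n0_gt0 : (0 < n0)%N by case: n0 ltn0; rewrite ?f0.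
  apply: lt_le_trans (ule _ n0_gt0).
  by rewrite /u divr_gt0 ?ltr0n // subr_gt0 ltr_nat.
exists l => //.
apply/cvgrPdist_le => e e0.
have [_ [N _ <-]] : exists2 x, E x & l - Num.min (e / 2) l < x.
  by apply: sup_adherent => //; rewrite lt_min l0 divr_gt0.
(* Taking the minimum with l makes a positive, so that a/M is a lower bound
   for the ratio that survives the rounding of n to a multiple of M. *)
set M := N.+1; set a : R := (f M)%:R - c%:R => ltu.
have M0 : 0 < M%:R :> R by rewrite ltr0n.
have a0 : 0 < a.
  have : 0 < a / M%:R.
    by apply: le_lt_trans ltu; rewrite subr_ge0 ge_min lexx orbT.
  by rewrite pmulr_lgt0 // invr_gt0.
have ltu2 : l - e / 2 < a / M%:R.
  by apply: le_lt_trans ltu; rewrite lerD2l lerN2 ge_min lexx.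
near=> n.
have n0' : 0 < n%:R :> R by near: n; apply: nbhs_infty_gtr.
have cn : c%:R / e <= n%:R :> R by near: n; apply: nbhs_infty_ger.
have an : a / (e / 2) <= n%:R :> R by near: n; apply: nbhs_infty_ger.
rewrite ler_distlC; apply/andP; split.
  have lower : (n%:R - M%:R) * a <= M%:R * (f n)%:R.
    have := superadditive_iter (n %/ M) M (n %% M) fD.
    rewrite -divn_eq -(ler_nat R) natrD !natrM => fn.
    have qn : n%:R - M%:R <= (n %/ M)%:R * M%:R :> R.
      rewrite -natrM lerBlDr -natrD ler_nat {1}(divn_eq n M) leq_add2l.
      by rewrite ltnW // ltn_pmod.
    apply: (@le_trans _ _ ((n %/ M)%:R * M%:R * a)).
      by rewrite ler_wpM2r // ltW.
    have le : (n %/ M)%:R * a <= (f n)%:R by rewrite /a mulrBr lerBlDr.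
    by rewrite mulrAC mulrC ler_pM2l.
  have : a / M%:R - a / n%:R <= (f n)%:R / n%:R.
    rewrite ler_pdivlMr // -(ler_pM2l M0).
    apply: le_trans lower; rewrite le_eqVlt; apply/orP; left; apply/eqP.
    by field; rewrite !lt0r_neq0.
  have : a / n%:R <= e / 2.
    by rewrite ler_pdivrMr // mulrC -ler_pdivrMr // divr_gt0.
  lra.
have : c%:R / n%:R <= e by rewrite ler_pdivrMr // mulrC -ler_pdivrMr.
have := ule n; rewrite -(ltr_nat R) => /(_ n0').
rewrite /u mulrBl; lra.
Unshelve. all: by end_near.
Qed.

Theorem theorem3 (R : realType) (H : sgraph)
    (H2 : two_connected H)
    (HK3 : ~ isomorphic H (complete_graph 3))
    (HK4 : ~ isomorphic H (complete_graph 4)) :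
  ((fun n : nat => (gap H n)%:R / n%:R : R) @ \oo --> limp R H)
  /\ 0 < limp R H.
Proof.
have [l l0 gap_l] := superadditive_ratio R (gap_add H2)
  (fun n => gap_linear n H2) (gap_unbounded (#|H| ^ 2) H2 HK3 HK4).
suff -> : limp R H = l by [].
by have [] := cvg_limn_inf_sup gap_l.
Qed.
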